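(* Let $x^*$ be a locally optimal solution of the SDCMPCC $\min_{x\in\mathbb{X}}\{\varphi(x)\ \text{s.t.}\ \Upsilon(x)\in K\times\Omega\}$. Suppose that the multifunction $\mathcal{F}(z):=\Upsilon(z)-K\times\Omega$ is metrically subregular at $x^*$ for the origin. Then $\mathcal{M}(x^* )\neq\emptyset$. Moreover, for any $d\in\mathcal{C}(x^* )$ and any nonempty convex set $T(d)\subseteq\mathcal{T}^2_{K\times\Omega}(\Upsilon(x^* );\Upsilon'(x^* )d)$ such that \[ \mathrm{ri}\big[T(d)+\mathcal{T}^c_{K\times\Omega}(\Upsilon(x^* ))\big]\cap\big[\mathrm{range}(\Upsilon'(x^* ))+\nabla^2\Upsilon(x^* )(d,d)\big]\neq\emptyset, \] it holds that \[ \sup_{(\xi,\Gamma)\in\mathcal{M}^c(x^* )}\Big\{\langle d,\nabla^2_{xx}L(x^*,\xi,\Gamma)d\rangle-\sigma\big((\xi,\Gamma)\mid T(d)\big)\Big\}\ge0. \]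
   Context: Standing setting: $\mathbb{X},\mathbb{Y}$ are finite-dimensional real inner product spaces; $\mathbb{S}^n$ is the space of real symmetric $n\times n$ matrices with the trace inner product; $\mathbb{S}^n_\pm$ the positive/negative semidefinite cones. $\varphi:\mathbb{X}\to\mathbb{R}$, $h:\mathbb{X}\to\mathbb{Y}$, $\theta,\zeta:\mathbb{X}\to\mathbb{S}^n$ are twice differentiable; $K\subseteq\mathbb{Y}$ is a closed convex cone which is second-order regular (at every point in every tangent direction). $\Omega:=\{(X,Y)\mid X\in\mathbb{S}^n_+,\ Y\in\mathbb{S}^n_-,\ \langle X,Y\rangle=0\}$, $\Theta(x):=(\theta(x),\zeta(x))$, $\Upsilon(x):=(h(x),\Theta(x))$; the feasible set is $\mathcal{S}=\{x\mid\Upsilon(x)\in K\times\Omega\}$. For a closed set $C$ and $y\in C$: Bouligand tangent cone $\mathcal{T}_C(y)=\{v\mid\exists t_k\downarrow0,v^k\to v,\ y+t_kv^k\in C\}$; Clarke tangent cone $\mathcal{T}^c_C(y)=\{v\mid \forall t_k\downarrow0,\ \forall y^k\to y \text{ in } C,\ \exists v^k\to v,\ y^k+t_kv^k\in C\}$; regular normal cone $\widehat{\mathcal{N}}_C(y)=[\mathcal{T}_C(y)]^\circ$ (negative polar); limiting normal cone $\mathcal{N}_C(y)=\{v\mid\exists y^k\to y \text{ in } C,\ v^k\to v,\ v^k\in\widehat{\mathcal{N}}_C(y^k)\}$; Clarke normal cone $\mathcal{N}^c_C(y)=\mathrm{cl\,co}\,\mathcal{N}_C(y)$; outer second-order tangent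 set $\mathcal{T}^2_C(y;v)=\{w\mid\exists t_k\downarrow0,\ \mathrm{dist}(y+t_kv+\tfrac12t_k^2w,C)=o(t_k^2)\}$. $\sigma(\cdot\mid T)$ is the support function of $T$, $\mathrm{ri}$ the relative interior. Critical cone: $\mathcal{C}(x)=\{d\mid\varphi'(x)d\le0,\ \Upsilon'(x)d\in\mathcal{T}_{K\times\Omega}(\Upsilon(x))\}$. Lagrangian: $L(x,\xi,\Gamma)=\varphi(x)+\langle\xi,h(x)\rangle+\langle\Gamma,\Theta(x)\rangle$ for $(\xi,\Gamma)\in\mathbb{Y}\times(\mathbb{S}^n\times\mathbb{S}^n)$. Multiplier sets: $\mathcal{M}^c(x)=\{(\xi,\Gamma)\mid\nabla_xL(x,\xi,\Gamma)=0,\ (\xi,\Gamma)\in\mathcal{N}^c_{K\times\Omega}(\Upsilon(x))\}$, $\mathcal{M}(x)$ and $\widehat{\mathcal{M}}(x)$ defined likewise with $\mathcal{N}_{K\times\Omega}$ and $\widehat{\mathcal{N}}_{K\times\Omega}$ respectively. $\mathcal{F}(z)=\Upsilon(z)-K\times\Omega$ is metrically subregular at $x^*$ for the origin if there are $\kappa,\rho>0$ with $\mathrm{dist}(x,\mathcal{S})\le\kappa\,\mathrm{dist}(\Upsilon(x),K\times\Omega)$ for all $\|x-x^*\|\le\rho$. $\nabla^2\Upsilon(x)(d,d)$ denotes the second derivative of $\Upsilon$ at $x$ evaluated at $(d,d)$. *)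

(* Defs.v *)
From Stdlib Require Import Reals Lra Lia List.
Open Scope R_scope.

(* Real inner product spaces: carrier + operations.  The axioms of a  *)
(* finite-dimensional real inner product space are the predicate      *)
(* [fd_ips] below (assumed for abstract spaces X, Y).                  *)
Record ipspace := mkIPS {
  car :> Type;
  vzero : car;
  vadd : car -> car -> car;
  vopp : car -> car;
  vscal : R -> car -> car;
  ip : car -> car -> R
}.
Arguments vzero {_}.
Arguments vadd {_} _ _.
Arguments vopp {_} _.
Arguments vscal {_} _ _.
Arguments ip {_} _ _.

Definition vsub {E : ipspace} (x y : E) : E := vadd x (vopp y).
Definition norm {E : ipspace} (x : E) : R := sqrt (ip x x).

Fixpoint lincomb {E : ipspace} (l : list (R * E)) : E :=
  match l with
  | nil => vzero
  | (c, b) :: l' => vadd (vscal c b) (lincomb l')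
  end.
Fixpoint coefsum {E : ipspace} (l : list (R * E)) : R :=
  match l with nil => 0 | (c, _) :: l' => c + coefsum l' end.

Definition fd_ips (E : ipspace) : Prop :=
  (forall x y z : E, vadd x (vadd y z) = vadd (vadd x y) z) /\
  (forall x y : E, vadd x y = vadd y x) /\
  (forall x : E, vadd x vzero = x) /\
  (forall x : E, vadd x (vopp x) = vzero) /\
  (forall (a : R) (x y : E), vscal a (vadd x y) = vadd (vscal a x) (vscal a y)) /\
  (forall (a b : R) (x : E), vscal (a + b) x = vadd (vscal a x) (vscal b x)) /\
  (forall (a b : R) (x : E), vscal (a * b) x = vscal a (vscal b x)) /\
  (forall x : E, vscal 1 x = x) /\
  (forall x y : E, ip x y = ip y x) /\
  (forall (a b : R) (x y z : E),
      ip (vadd (vscal a x) (vscal b y)) z = a * ip x z + b * ip y z) /\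
  (forall x : E, 0 <= ip x x) /\
  (forall x : E, ip x x = 0 -> x = vzero) /\
  (exists bs : list E, forall x : E,
      exists l : list (R * E), Forall (fun p => In (snd p) bs) l /\ x = lincomb l).

Definition R_ips : ipspace :=
  mkIPS R 0 Rplus Ropp Rmult Rmult.

Definition prod_ips (E F : ipspace) : ipspace :=
  mkIPS (E * F)%type (vzero, vzero)
    (fun p q => (vadd (fst p) (fst q), vadd (snd p) (snd q)))
    (fun p => (vopp (fst p), vopp (snd p)))
    (fun a p => (vscal a (fst p), vscal a (snd p)))
    (fun p q => ip (fst p) (fst q) + ip (snd p) (snd q)).

Fixpoint sumR (n : nat) (f : nat -> R) : R :=
  match n with O => 0 | S k => sumR k f + f k end.

Definition is_symn (n : nat) (A : nat -> nat -> R) : Prop :=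
  (forall i j, A i j = A j i) /\
  (forall i j, (n <= i)%nat \/ (n <= j)%nat -> A i j = 0).

Definition Symn (n : nat) := {A : nat -> nat -> R | is_symn n A}.

Lemma symn_zero n : is_symn n (fun _ _ => 0).
Proof. split; intros; reflexivity. Qed.
Lemma symn_add n (A B : Symn n) :
  is_symn n (fun i j => proj1_sig A i j + proj1_sig B i j).
Proof.
  destruct A as [A [HA1 HA2]], B as [B [HB1 HB2]]; simpl; split; intros i j.
  - rewrite HA1, HB1; reflexivity.
  - intro H; rewrite (HA2 i j H), (HB2 i j H); ring.
Qed.
Lemma symn_opp n (A : Symn n) : is_symn n (fun i j => - proj1_sig A i j).
Proof.
  destruct A as [A [HA1 HA2]]; simpl; split; intros i j.
  - rewrite HA1; reflexivity.
  - intro H; rewrite (HA2 i j H); ring.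
Qed.
Lemma symn_scal n (a : R) (A : Symn n) : is_symn n (fun i j => a * proj1_sig A i j).
Proof.
  destruct A as [A [HA1 HA2]]; simpl; split; intros i j.
  - rewrite HA1; reflexivity.
  - intro H; rewrite (HA2 i j H); ring.
Qed.

Definition trace_ip (n : nat) (A B : nat -> nat -> R) : R :=
  sumR n (fun i => sumR n (fun j => A i j * B j i)).

Definition Sym_ips (n : nat) : ipspace :=
  mkIPS (Symn n) (exist _ (fun _ _ => 0) (symn_zero n))
    (fun A B => exist _ _ (symn_add n A B))
    (fun A => exist _ _ (symn_opp n A))
    (fun a A => exist _ _ (symn_scal n a A))
    (fun A B => trace_ip n (proj1_sig A) (proj1_sig B)).

Definition quadform (n : nat) (A : nat -> nat -> R) (v : nat -> R) : R :=
  sumR n (fun i => sumR n (fun j => v i * A i j * v j)).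

Definition PSD (n : nat) (A : Symn n) : Prop :=
  forall v : nat -> R, 0 <= quadform n (proj1_sig A) v.
Definition NSD (n : nat) (A : Symn n) : Prop :=
  forall v : nat -> R, quadform n (proj1_sig A) v <= 0.

Definition Omega (n : nat) : prod_ips (Sym_ips n) (Sym_ips n) -> Prop :=
  fun p => PSD n (fst p) /\ NSD n (snd p) /\ @ip (Sym_ips n) (fst p) (snd p) = 0.

Definition seq_cv {E : ipspace} (u : nat -> E) (a : E) : Prop :=
  forall eps, 0 < eps -> exists N, forall k, (N <= k)%nat -> norm (vsub (u k) a) < eps.

Definition R_cv (t : nat -> R) (l : R) : Prop :=
  forall eps, 0 < eps -> exists N, forall k, (N <= k)%nat -> Rabs (t k - l) < eps.

Definition down0 (t : nat -> R) : Prop := (forall k, 0 < t k) /\ R_cv t 0.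

(* dist(z, C) <= r   (dist = inf_{c in C} ||z - c||, = +oo if C empty) *)
Definition dist_le {E : ipspace} (z : E) (C : E -> Prop) (r : R) : Prop :=
  forall eta, 0 < eta -> exists c, C c /\ norm (vsub z c) <= r + eta.

Definition closed {E : ipspace} (C : E -> Prop) : Prop :=
  forall (u : nat -> E) (a : E), (forall k, C (u k)) -> seq_cv u a -> C a.

Definition convex {E : ipspace} (C : E -> Prop) : Prop :=
  forall x y : E, C x -> C y -> forall l, 0 <= l <= 1 ->
    C (vadd (vscal l x) (vscal (1 - l) y)).

Definition cone {E : ipspace} (C : E -> Prop) : Prop :=
  C vzero /\ forall (a : R) (x : E), 0 <= a -> C x -> C (vscal a x).

Definition closed_convex_cone {E : ipspace} (C : E -> Prop) : Prop :=
  closed C /\ convex C /\ cone C.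

Definition set_sum {E : ipspace} (A B : E -> Prop) : E -> Prop :=
  fun z => exists a b, A a /\ B b /\ z = vadd a b.

Definition prod_set {E F : ipspace} (A : E -> Prop) (B : F -> Prop)
  : prod_ips E F -> Prop := fun p => A (fst p) /\ B (snd p).

Definition aff_hull {E : ipspace} (A : E -> Prop) : E -> Prop :=
  fun z => exists l : list (R * E),
    Forall (fun p => A (snd p)) l /\ coefsum l = 1 /\ z = lincomb l.
Definition conv_hull {E : ipspace} (A : E -> Prop) : E -> Prop :=
  fun z => exists l : list (R * E),
    Forall (fun p => 0 <= fst p /\ A (snd p)) l /\ coefsum l = 1 /\ z = lincomb l.
Definition closure {E : ipspace} (A : E -> Prop) : E -> Prop :=
  fun z => forall eps, 0 < eps -> exists a, A a /\ norm (vsub z a) < eps.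
Definition rel_int {E : ipspace} (A : E -> Prop) : E -> Prop :=
  fun z => A z /\ exists eps, 0 < eps /\
    forall b, aff_hull A b -> norm (vsub b z) < eps -> A b.

Definition bouligand_tangent {E : ipspace} (C : E -> Prop) (y : E) : E -> Prop :=
  fun v => exists (t : nat -> R) (vk : nat -> E),
    down0 t /\ seq_cv vk v /\ forall k, C (vadd y (vscal (t k) (vk k))).

Definition clarke_tangent {E : ipspace} (C : E -> Prop) (y : E) : E -> Prop :=
  fun v => forall (t : nat -> R) (yk : nat -> E),
    down0 t -> (forall k, C (yk k)) -> seq_cv yk y ->
    exists vk : nat -> E, seq_cv vk v /\ forall k, C (vadd (yk k) (vscal (t k) (vk k))).

Definition regular_normal {E : ipspace} (C : E -> Prop) (y : E) : E -> Prop :=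
  fun v => forall u, bouligand_tangent C y u -> ip v u <= 0.

Definition limiting_normal {E : ipspace} (C : E -> Prop) (y : E) : E -> Prop :=
  fun v => exists (yk vk : nat -> E),
    (forall k, C (yk k)) /\ seq_cv yk y /\ seq_cv vk v /\
    forall k, regular_normal C (yk k) (vk k).

Definition clarke_normal {E : ipspace} (C : E -> Prop) (y : E) : E -> Prop :=
  closure (conv_hull (limiting_normal C y)).

Definition so_path {E : ipspace} (y v w : E) (t : R) : E :=
  vadd y (vadd (vscal t v) (vscal (/ 2 * (t * t)) w)).

Definition outer_so_tangent {E : ipspace} (C : E -> Prop) (y v : E) : E -> Prop :=
  fun w => exists t : nat -> R, down0 t /\
    forall eps, 0 < eps -> exists N, forall k, (N <= k)%nat ->
      dist_le (so_path y v w (t k)) C (eps * (t k * t k)).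

Definition inner_so_tangent {E : ipspace} (C : E -> Prop) (y v : E) : E -> Prop :=
  fun w => forall eps, 0 < eps -> exists del, 0 < del /\
    forall t, 0 < t < del -> dist_le (so_path y v w t) C (eps * (t * t)).

(* second-order regularity (Bonnans-Shapiro, Def. 3.85) at every point of C
   in every tangent direction *)
Definition second_order_regular {E : ipspace} (C : E -> Prop) : Prop :=
  forall y v : E, C y -> bouligand_tangent C y v ->
    forall (t : nat -> R) (w : nat -> E),
      down0 t ->
      seq_cv (fun k => vscal (t k) (w k)) vzero ->
      (forall k, C (so_path y v (w k) (t k))) ->
      forall eps, 0 < eps -> exists N, forall k, (N <= k)%nat ->
        dist_le (w k) (inner_so_tangent C y v) eps.

Definition is_linear {E F : ipspace} (L : E -> F) : Prop :=
  forall (a b : R) (x y : E), L (vadd (vscal a x) (vscal b y)) = vadd (vscal a (L x)) (vscal b (L y)).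

Definition has_deriv_at {E F : ipspace} (f : E -> F) (x : E) (L : E -> F) : Prop :=
  is_linear L /\
  forall eps, 0 < eps -> exists del, 0 < del /\ forall h : E, norm h < del ->
    norm (vsub (vsub (f (vadd x h)) (f x)) (L h)) <= eps * norm h.

Definition twice_diff {E F : ipspace} (f : E -> F) (Df : E -> E -> F)
  (D2f : E -> E -> E -> F) : Prop :=
  forall x : E,
    has_deriv_at f x (Df x) /\
    (forall h, is_linear (D2f x h)) /\ (forall u, is_linear (fun h => D2f x h u)) /\
    forall eps, 0 < eps -> exists del, 0 < del /\ forall h : E, norm h < del ->
      forall u : E,
        norm (vsub (vsub (Df (vadd x h) u) (Df x u)) (D2f x h u)) <= eps * norm h * norm u.

Definition Zsp (Y : ipspace) (n : nat) : ipspace :=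
  prod_ips Y (prod_ips (Sym_ips n) (Sym_ips n)).

Definition KOmega {Y : ipspace} (n : nat) (K : Y -> Prop) : Zsp Y n -> Prop :=
  prod_set K (Omega n).

Definition Ups {X Y : ipspace} {n : nat} (h : X -> Y) (theta zeta : X -> Sym_ips n)
  : X -> Zsp Y n := fun x => (h x, (theta x, zeta x)).
Definition DUps {X Y : ipspace} {n : nat} (Dh : X -> X -> Y)
  (Dtheta Dzeta : X -> X -> Sym_ips n) : X -> X -> Zsp Y n :=
  fun x v => (Dh x v, (Dtheta x v, Dzeta x v)).
Definition D2Ups {X Y : ipspace} {n : nat} (D2h : X -> X -> X -> Y)
  (D2theta D2zeta : X -> X -> X -> Sym_ips n) : X -> X -> X -> Zsp Y n :=
  fun x u v => (D2h x u v, (D2theta x u v, D2zeta x u v)).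

Definition feasible {X Z : ipspace} (U : X -> Z) (C : Z -> Prop) : X -> Prop :=
  fun x => C (U x).

Definition local_min {X : ipspace} (phi : X -> R) (S : X -> Prop) (xs : X) : Prop :=
  S xs /\ exists rho, 0 < rho /\
    forall x, S x -> norm (vsub x xs) < rho -> phi xs <= phi x.

Definition metric_subregular {X Z : ipspace} (U : X -> Z) (C : Z -> Prop) (xs : X) : Prop :=
  exists kappa rho, 0 < kappa /\ 0 < rho /\
    forall x, norm (vsub x xs) <= rho ->
      forall r, dist_le (U x) C r -> dist_le x (feasible U C) (kappa * r).

(* Lagrangian L(x, (xi,Gamma)) = phi(x) + <xi,h(x)> + <Gamma,Theta(x)>
   = phi(x) + <(xi,Gamma), Upsilon(x)> *)
Definition Lagr {X Z : ipspace} (phi : X -> R) (U : X -> Z) (x : X) (m : Z) : R :=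
  phi x + ip m (U x).

Definition grad_Lagr_zero {X Z : ipspace} (Dphi : X -> X -> R) (DU : X -> X -> Z)
  (x : X) (m : Z) : Prop :=
  forall v : X, Dphi x v + ip m (DU x v) = 0.

Definition hess_Lagr {X Z : ipspace} (D2phi : X -> X -> X -> R) (D2U : X -> X -> X -> Z)
  (x : X) (m : Z) (d : X) : R :=
  D2phi x d d + ip m (D2U x d d).

Definition mult_set {X Z : ipspace} (N : (Z -> Prop) -> Z -> Z -> Prop)
  (Dphi : X -> X -> R) (U : X -> Z) (DU : X -> X -> Z) (C : Z -> Prop) (x : X) : Z -> Prop :=
  fun m => grad_Lagr_zero Dphi DU x m /\ N C (U x) m.

Definition critical_cone {X Z : ipspace} (Dphi : X -> X -> R) (U : X -> Z)
  (DU : X -> X -> Z) (C : Z -> Prop) (x : X) : X -> Prop :=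
  fun d => Dphi x d <= 0 /\ bouligand_tangent C (U x) (DU x d).

Definition support_le {Z : ipspace} (T : Z -> Prop) (m : Z) (s : R) : Prop :=
  forall w, T w -> ip m w <= s.

(* sup_{m in M} { q(m) - sigma(m | T) } >= 0, where sigma(m|T) may be +oo
   (so each term lies in [-oo, +oo)) *)
Definition sup_q_minus_support_ge0 {Z : ipspace} (M : Z -> Prop) (q : Z -> R)
  (T : Z -> Prop) : Prop :=
  forall eps, 0 < eps -> exists m, M m /\ support_le T m (q m + eps).

(* Main.v *)
Require Import Defs.
From Stdlib Require Import Reals Lra Lia List Classical IndefiniteDescription.
From Stdlib Require Import FunctionalExtensionality ProofIrrelevance.
Import ListNotations.
Open Scope R_scope.

(** Write [C] for [K x Omega], [U] for [Upsilon] and [y] for [U xs].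

    First order: subregularity makes [phi + L dist(U, C)] an exact penalty.  A minimiser of
    [phi x + |x - xs|^2 + k |U x - z|^2] over [x] near [xs] and [z] in [C] near [y] has
    [2 k (U x - z)] as a regular normal to [C] at [z]; exactness bounds these normals by [2 L],
    and any cluster point as [k] grows is a limiting multiplier.

    Second order: [T(d) + T^c] is a convex subset of the outer second-order tangent set.
    If [U' v + U''(d,d)] lies in it, then the parabola [xs + t d + t^2/2 v] is within [o(t^2)]
    of the feasible set, so [phi' v + phi''(d,d) >= 0].  The relative interior condition turns
    this into a single multiplier [m] by finite-dimensional duality.  Since [T^c] is a cone, [m]
    lies in its polar, and this polar is contained in the Clarke normal cone because a vector
    polar to the limiting normals is a Clarke tangent. *)

(** * Inner product spaces and limits *)

(* The distance to [C] is not differentiable, so the penalty uses the smooth square [|U x - z|^2]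
   with [z] in [C] as a second variable: stationarity in [x] yields the gradient equation and
   minimality in [z] yields the normal. Exactness keeps the normals bounded because comparison with
   [(xs, y)] leaves [k |U x - z|^2 <= L |U x - z|].

   The sum [T(d) + T^c] stays convex although [C] need not be: Clarke tangency quantifies over all
   base points near [y], and this makes [T^c] a convex cone. That a vector [u] polar to the limiting
   normals is a Clarke tangent is the delicate inclusion. If it fails, the distance to [C] grows at
   a linear rate along [u] from points tending to [y], and a mean value inequality turns this growth
   into normals with [<lam, u>] bounded away from zero; they come from a quadratic penalty again.

   Finite dimension acts through orthonormal bases: they give compactness, bounds on linear maps,
   and an induction that performs the separation one coordinate at a time. *)
Existing Class fd_ips.

(** This destroys its argument, so a proof that still needs the instance applies it to a copy. *)
Ltac ips_axioms H :=
  destruct H as (Hassoc & Hcomm & Hzero & Hopp & Hdistr & Hdistr' & Hmul & Hone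
                 & Hsym & Hlin & Hpos & Hdef & Hgen).

Lemma vadd_cancel_zero {E : ipspace} {HE : fd_ips E} (x : E) : vadd x x = x -> x = vzero.
Proof.
  intro H; ips_axioms HE.
  rewrite <- (Hzero x), <- (Hopp x), Hassoc, H; reflexivity.
Qed.

Lemma vscal0 {E : ipspace} {HE : fd_ips E} (x : E) : vscal 0 x = vzero.
Proof.
  apply vadd_cancel_zero; pose proof HE as HE'; ips_axioms HE'.
  rewrite <- Hdistr', Rplus_0_r; reflexivity.
Qed.

Lemma ip_sym {E : ipspace} {HE : fd_ips E} (x y : E) : ip x y = ip y x.
Proof. ips_axioms HE; apply Hsym. Qed.

Lemma ip_addl {E : ipspace} {HE : fd_ips E} (x y z : E) : ip (vadd x y) z = ip x z + ip y z.
Proof.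
  ips_axioms HE.
  rewrite <- (Hone x) at 1; rewrite <- (Hone y) at 1; rewrite Hlin; ring.
Qed.

Lemma ip_zerol {E : ipspace} {HE : fd_ips E} (z : E) : ip vzero z = 0.
Proof.
  pose proof HE as HE'; ips_axioms HE'.
  assert (H : ip (vadd vzero vzero) z = ip (@vzero E) z) by (rewrite Hzero; reflexivity).
  rewrite ip_addl in H; lra.
Qed.

Lemma ip_scall {E : ipspace} {HE : fd_ips E} (a : R) (x z : E) : ip (vscal a x) z = a * ip x z.
Proof.
  pose proof HE as HE'; ips_axioms HE'.
  rewrite <- (Hzero (vscal a x)), <- (vscal0 x), Hlin; ring.
Qed.

Lemma ip_oppl {E : ipspace} {HE : fd_ips E} (x z : E) : ip (vopp x) z = - ip x z.
Proof.
  pose proof HE as HE'; ips_axioms HE'.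
  assert (H : ip (vadd x (vopp x)) z = 0) by (rewrite Hopp; apply ip_zerol).
  rewrite ip_addl in H; lra.
Qed.

Lemma ip_addr {E : ipspace} {HE : fd_ips E} (x y z : E) : ip z (vadd x y) = ip z x + ip z y.
Proof. rewrite !(ip_sym z); apply ip_addl. Qed.
Lemma ip_scalr {E : ipspace} {HE : fd_ips E} (a : R) (x z : E) : ip z (vscal a x) = a * ip z x.
Proof. rewrite !(ip_sym z); apply ip_scall. Qed.
Lemma ip_oppr {E : ipspace} {HE : fd_ips E} (x z : E) : ip z (vopp x) = - ip z x.
Proof. rewrite !(ip_sym z); apply ip_oppl. Qed.
Lemma ip_zeror {E : ipspace} {HE : fd_ips E} (z : E) : ip z vzero = 0.
Proof. rewrite ip_sym; apply ip_zerol. Qed.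

Lemma ip_pos {E : ipspace} {HE : fd_ips E} (x : E) : 0 <= ip x x.
Proof. ips_axioms HE; apply Hpos. Qed.
Lemma ip_def {E : ipspace} {HE : fd_ips E} (x : E) : ip x x = 0 -> x = vzero.
Proof. ips_axioms HE; apply Hdef. Qed.

Ltac ipl := unfold vsub; repeat first
  [ rewrite ip_addl | rewrite ip_scall | rewrite ip_oppl | rewrite ip_zerol ].
Ltac iplr := unfold vsub; repeat first
  [ rewrite ip_addl | rewrite ip_scall | rewrite ip_oppl | rewrite ip_zerol
  | rewrite ip_addr | rewrite ip_scalr | rewrite ip_oppr | rewrite ip_zeror ].

Lemma vsub0_eq {E : ipspace} {HE : fd_ips E} (x y : E) : vsub x y = vzero -> x = y.
Proof.
  pose proof HE as HE'; ips_axioms HE'; unfold vsub; intro H.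
  rewrite <- (Hzero x), <- (Hopp y), (Hcomm y), Hassoc, H, Hcomm, Hzero; reflexivity.
Qed.

Lemma ip_ext {E : ipspace} {HE : fd_ips E} (x y : E) : (forall e, ip x e = ip y e) -> x = y.
Proof.
  intro H; apply vsub0_eq, ip_def.
  ipl. rewrite (H (vadd x (vopp y))); ring.
Qed.

(** Pairing with an arbitrary vector turns a vector identity into an identity of reals, which [ring]
    can decide. *)
Ltac veq := apply ip_ext; let e := fresh "e" in intro e; ipl; try ring.

Lemma vadd_zero {E : ipspace} {HE : fd_ips E} (x : E) : vadd x vzero = x.
Proof. veq. Qed.
Lemma vscal1 {E : ipspace} {HE : fd_ips E} (x : E) : vscal 1 x = x.
Proof. veq. Qed.
Lemma vscal_vscal {E : ipspace} {HE : fd_ips E} (a b : R) (x : E) :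
  vscal a (vscal b x) = vscal (a * b) x.
Proof. veq. Qed.

Lemma norm_pos {E : ipspace} (x : E) : 0 <= norm x.
Proof. apply sqrt_pos. Qed.

Lemma norm_sq {E : ipspace} {HE : fd_ips E} (x : E) : norm x * norm x = ip x x.
Proof. apply sqrt_sqrt, ip_pos. Qed.

Lemma norm_le_sq {E : ipspace} {HE : fd_ips E} (x : E) (a : R) :
  0 <= a -> ip x x <= a * a -> norm x <= a.
Proof.
  intros Ha H; rewrite <- norm_sq in H; pose proof (norm_pos x).
  apply Rsqr_incr_0_var; auto.
Qed.

Lemma norm_zero {E : ipspace} {HE : fd_ips E} : norm (@vzero E) = 0.
Proof.
  apply Rle_antisym; [ apply norm_le_sq; rewrite ?ip_zerol; lra | apply norm_pos ].
Qed.

Lemma norm_eq0 {E : ipspace} {HE : fd_ips E} (x : E) : norm x = 0 -> x = vzero.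
Proof. intro H; apply ip_def; rewrite <- norm_sq, H; ring. Qed.

Lemma vsub_diag {E : ipspace} {HE : fd_ips E} (x : E) : vsub x x = vzero.
Proof. veq. Qed.

Lemma cauchy_schwarz {E : ipspace} {HE : fd_ips E} (x y : E) : ip x y <= norm x * norm y.
Proof.
  pose proof (norm_pos x) as Hx; pose proof (norm_pos y) as Hy.
  (* Expanding this square gives [|x| |y| <x, y> <= |x|^2 |y|^2]; the factor [|x| |y|] cancels once
     both norms are known to be nonzero. *)
  pose proof (ip_pos (vsub (vscal (norm y) x) (vscal (norm x) y))) as H.
  revert H; iplr; intro H.
  rewrite (ip_sym y x), <- !norm_sq in H.
  destruct (Req_dec (norm x) 0) as [H0 | H0].
  { rewrite (norm_eq0 x H0), ip_zerol, norm_zero; lra. }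
  destruct (Req_dec (norm y) 0) as [H1 | H1].
  { rewrite (norm_eq0 y H1), ip_zeror, norm_zero; lra. }
  apply Rmult_le_reg_l with (norm x * norm y); [ apply Rmult_lt_0_compat; lra | nra ].
Qed.

Lemma norm_scal {E : ipspace} {HE : fd_ips E} (a : R) (x : E) :
  norm (vscal a x) = Rabs a * norm x.
Proof.
  unfold norm at 1; iplr.
  replace (a * (a * ip x x)) with (Rsqr a * ip x x) by (unfold Rsqr; ring).
  rewrite sqrt_mult; [ rewrite sqrt_Rsqr_abs; reflexivity | apply Rle_0_sqr | apply ip_pos ].
Qed.

Lemma norm_scal_pos {E : ipspace} {HE : fd_ips E} (a : R) (x : E) :
  0 <= a -> norm (vscal a x) = a * norm x.
Proof. intro; rewrite norm_scal, Rabs_pos_eq; auto. Qed.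

Lemma norm_opp {E : ipspace} {HE : fd_ips E} (x : E) : norm (vopp x) = norm x.
Proof. unfold norm; f_equal; iplr; ring. Qed.

Lemma norm_sub_sym {E : ipspace} {HE : fd_ips E} (x y : E) : norm (vsub x y) = norm (vsub y x).
Proof. rewrite <- norm_opp; f_equal; veq. Qed.

Lemma cauchy_schwarz_abs {E : ipspace} {HE : fd_ips E} (x y : E) :
  Rabs (ip x y) <= norm x * norm y.
Proof.
  apply Rabs_le; split; [ | apply cauchy_schwarz ].
  pose proof (cauchy_schwarz (vopp x) y) as H; rewrite ip_oppl, norm_opp in H; lra.
Qed.

Lemma norm_triangle {E : ipspace} {HE : fd_ips E} (x y : E) :
  norm (vadd x y) <= norm x + norm y.
Proof.
  pose proof (norm_pos x); pose proof (norm_pos y).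
  apply norm_le_sq; [ lra | ].
  iplr; pose proof (cauchy_schwarz x y).
  rewrite (ip_sym y x), <- !norm_sq; nra.
Qed.

Lemma norm_sub_triangle {E : ipspace} {HE : fd_ips E} (y x z : E) :
  norm (vsub x z) <= norm (vsub x y) + norm (vsub y z).
Proof.
  replace (vsub x z) with (vadd (vsub x y) (vsub y z)) by veq; apply norm_triangle.
Qed.

Lemma norm_le_sub {E : ipspace} {HE : fd_ips E} (x y : E) :
  norm x <= norm y + norm (vsub x y).
Proof. replace x with (vadd y (vsub x y)) at 1 by veq; apply norm_triangle. Qed.

Lemma norm_sub_add {E : ipspace} {HE : fd_ips E} (x y : E) : norm (vsub x y) <= norm x + norm y.
Proof. unfold vsub; rewrite <- (norm_opp y); apply norm_triangle. Qed.

Lemma seq_cv_ext {E : ipspace} (u v : nat -> E) (a : E) :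
  (forall k, u k = v k) -> seq_cv u a -> seq_cv v a.
Proof.
  intros H Hu eps He; destruct (Hu eps He) as [N HN]; exists N; intros k Hk.
  rewrite <- H; auto.
Qed.

Lemma R_cv_const (a : R) : R_cv (fun _ => a) a.
Proof. intros eps He; exists 0%nat; intros; rewrite Rminus_diag, Rabs_R0; auto. Qed.

Lemma R_cv_squeeze0 (u b : nat -> R) :
  (exists N, forall k, (N <= k)%nat -> Rabs (u k) <= b k) -> R_cv b 0 -> R_cv u 0.
Proof.
  intros [N0 H0] Hb eps He; destruct (Hb eps He) as [N HN].
  exists (Nat.max N0 N); intros k Hk.
  specialize (H0 k ltac:(lia)); specialize (HN k ltac:(lia)).
  pose proof (Rle_abs (b k - 0)); rewrite !Rminus_0_r in *; lra.
Qed.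

Lemma R_cv_iff (u : nat -> R) (a : R) : R_cv u a <-> Un_cv u a.
Proof.
  split; intros H eps He; destruct (H eps He) as [N HN]; exists N; intros k Hk; apply HN; lia.
Qed.

Lemma R_cv_plus u v a b : R_cv u a -> R_cv v b -> R_cv (fun k => u k + v k) (a + b).
Proof. rewrite !R_cv_iff; apply CV_plus. Qed.
Lemma R_cv_mult u v a b : R_cv u a -> R_cv v b -> R_cv (fun k => u k * v k) (a * b).
Proof. rewrite !R_cv_iff; apply CV_mult. Qed.
Lemma R_cv_scal c u a : R_cv u a -> R_cv (fun k => c * u k) (c * a).
Proof. intro; apply R_cv_mult; auto using R_cv_const. Qed.

Lemma R_cv_unique u a b : R_cv u a -> R_cv u b -> a = b.
Proof. rewrite !R_cv_iff; apply UL_sequence. Qed.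

Lemma R_cv_le (u v : nat -> R) a b :
  (forall k, u k <= v k) -> R_cv u a -> R_cv v b -> a <= b.
Proof.
  intros H Hu Hv; apply Rnot_lt_le; intro Hlt.
  destruct (Hu ((a - b) / 2)) as [N HN]; [ lra | ].
  destruct (Hv ((a - b) / 2)) as [M HM]; [ lra | ].
  specialize (HN (N + M)%nat ltac:(lia)); specialize (HM (N + M)%nat ltac:(lia)).
  specialize (H (N + M)%nat).
  apply Rabs_def2 in HN; apply Rabs_def2 in HM; lra.
Qed.

Lemma R_cv_sub u a (s : nat -> nat) :
  (forall k, (k <= s k)%nat) -> R_cv u a -> R_cv (fun k => u (s k)) a.
Proof.
  intros Hs Hu eps He; destruct (Hu eps He) as [N HN]; exists N; intros k Hk.
  apply HN; specialize (Hs k); lia.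
Qed.

Lemma seq_cv_sub {E : ipspace} (u : nat -> E) a (s : nat -> nat) :
  (forall k, (k <= s k)%nat) -> seq_cv u a -> seq_cv (fun k => u (s k)) a.
Proof.
  intros Hs Hu eps He; destruct (Hu eps He) as [N HN]; exists N; intros k Hk.
  apply HN; specialize (Hs k); lia.
Qed.

Lemma seq_cv_norm {E : ipspace} (u : nat -> E) (a : E) :
  seq_cv u a <-> R_cv (fun k => norm (vsub (u k) a)) 0.
Proof.
  split; intros H eps He; destruct (H eps He) as [N HN]; exists N; intros k Hk;
    specialize (HN k Hk); rewrite Rminus_0_r, Rabs_pos_eq in *; auto using norm_pos.
Qed.

Lemma seq_cv_bound {E : ipspace} (u : nat -> E) (a : E) (b : nat -> R) :
  (exists N, forall k, (N <= k)%nat -> norm (vsub (u k) a) <= b k) -> R_cv b 0 -> seq_cv u a.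
Proof.
  intros [N H] Hb; apply seq_cv_norm, R_cv_squeeze0 with b; auto.
  exists N; intros k Hk; rewrite Rabs_pos_eq; auto using norm_pos.
Qed.

Lemma seq_cv_const {E : ipspace} {HE : fd_ips E} (a : E) : seq_cv (fun _ => a) a.
Proof. intros eps He; exists 0%nat; intros; rewrite vsub_diag, norm_zero; auto. Qed.

Lemma seq_cv_add {E : ipspace} {HE : fd_ips E} (u v : nat -> E) (a b : E) :
  seq_cv u a -> seq_cv v b -> seq_cv (fun k => vadd (u k) (v k)) (vadd a b).
Proof.
  intros Hu Hv; apply seq_cv_bound with (fun k => norm (vsub (u k) a) + norm (vsub (v k) b)).
  - exists 0%nat; intros k _.
    replace (vsub (vadd (u k) (v k)) (vadd a b)) with (vadd (vsub (u k) a) (vsub (v k) b)) by veq.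
    apply norm_triangle.
  - replace 0 with (0 + 0) by ring; apply R_cv_plus; apply seq_cv_norm; auto.
Qed.

Lemma seq_cv_scal {E : ipspace} {HE : fd_ips E} (c : nat -> R) (g : R) (u : nat -> E) (a : E) :
  R_cv c g -> seq_cv u a -> seq_cv (fun k => vscal (c k) (u k)) (vscal g a).
Proof.
  intros Hc Hu.
  apply seq_cv_bound with
    (fun k => Rabs (c k - g) * (norm (vsub (u k) a) + norm a) + Rabs g * norm (vsub (u k) a)).
  - exists 0%nat; intros k _.
    replace (vsub (vscal (c k) (u k)) (vscal g a))
      with (vadd (vscal (c k - g) (vadd (vsub (u k) a) a)) (vscal g (vsub (u k) a))) by veq.
    eapply Rle_trans; [ apply norm_triangle | ]; rewrite !norm_scal.
    pose proof (norm_triangle (vsub (u k) a) a); pose proof (Rabs_pos (c k - g)); nra.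
  - apply seq_cv_norm in Hu.
    assert (Hc' : R_cv (fun k => Rabs (c k - g)) 0).
    { intros eps He; destruct (Hc eps He) as [N HN]; exists N; intros.
      rewrite Rminus_0_r, Rabs_Rabsolu; auto. }
    replace 0 with (0 * (0 + norm a) + Rabs g * 0) by ring.
    apply R_cv_plus; [ apply R_cv_mult | apply R_cv_scal ]; auto.
    apply R_cv_plus; auto using R_cv_const.
Qed.

Lemma seq_cv_sub_vec {E : ipspace} {HE : fd_ips E} (u v : nat -> E) (a b : E) :
  seq_cv u a -> seq_cv v b -> seq_cv (fun k => vsub (u k) (v k)) (vsub a b).
Proof.
  intros Hu Hv.
  apply seq_cv_ext with (fun k => vadd (u k) (vscal (-1) (v k))); [ intro; veq | ].
  replace (vsub a b) with (vadd a (vscal (-1) b)) by veq.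
  apply seq_cv_add; auto; apply seq_cv_scal; auto using R_cv_const.
Qed.

Lemma R_cv_ip {E : ipspace} {HE : fd_ips E} (u v : nat -> E) (a b : E) :
  seq_cv u a -> seq_cv v b -> R_cv (fun k => ip (u k) (v k)) (ip a b).
Proof.
  intros Hu Hv.
  assert (H : R_cv (fun k => ip (u k) (v k) - ip a b) 0).
  { apply R_cv_squeeze0 with
      (fun k => norm (vsub (u k) a) * (norm (vsub (v k) b) + norm b) + norm a * norm (vsub (v k) b)).
    - exists 0%nat; intros k _.
      replace (ip (u k) (v k) - ip a b)
        with (ip (vsub (u k) a) (vadd (vsub (v k) b) b) + ip a (vsub (v k) b)) by (iplr; ring).
      eapply Rle_trans; [ apply Rabs_triang | ].
      pose proof (cauchy_schwarz_abs (vsub (u k) a) (vadd (vsub (v k) b) b)).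
      pose proof (cauchy_schwarz_abs a (vsub (v k) b)).
      pose proof (norm_triangle (vsub (v k) b) b); pose proof (norm_pos (vsub (u k) a)); nra.
    - apply seq_cv_norm in Hu; apply seq_cv_norm in Hv.
      replace 0 with (0 * (0 + norm b) + norm a * 0) by ring.
      apply R_cv_plus; [ apply R_cv_mult | apply R_cv_scal ]; auto.
      apply R_cv_plus; auto using R_cv_const. }
  intros eps He; destruct (H eps He) as [N HN]; exists N; intros k Hk.
  specialize (HN k Hk); rewrite Rminus_0_r in HN; auto.
Qed.

Lemma norm_cv_le {E : ipspace} {HE : fd_ips E} (u : nat -> E) (a c : E) (M : R) :
  seq_cv u a -> (forall k, norm (vsub (u k) c) <= M) -> norm (vsub a c) <= M.
Proof.
  intros Hu H.
  assert (HM : 0 <= M) by (pose proof (norm_pos (vsub (u 0%nat) c)); specialize (H 0%nat); lra).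
  apply norm_le_sq; auto.
  apply R_cv_le with (fun k => ip (vsub (u k) c) (vsub (u k) c)) (fun _ => M * M).
  - intro k; rewrite <- norm_sq; pose proof (norm_pos (vsub (u k) c)); specialize (H k); nra.
  - apply R_cv_ip; apply seq_cv_sub_vec; auto using seq_cv_const.
  - apply R_cv_const.
Qed.

Lemma R_cv_inv_S : R_cv (fun k => / (INR k + 1)) 0.
Proof. apply R_cv_iff; intros eps He; apply (cv_infty_cv_0 (fun n => INR n + 1));
  [ | auto ]. intro M. destruct (INR_unbounded M) as [N HN]; exists N; intros k Hk.
  apply le_INR in Hk; lra. Qed.

Lemma inv_S_pos (k : nat) : 0 < / (INR k + 1).
Proof. pose proof (pos_INR k); apply Rinv_0_lt_compat; lra. Qed.

(** * Compactness and projections *)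

Fixpoint ortho {E : ipspace} (l : list E) : Prop :=
  match l with
  | nil => True
  | e :: l' => ip e e = 1 /\ (forall f, In f l' -> ip e f = 0) /\ ortho l'
  end.

Fixpoint expand {E : ipspace} (l : list E) (x : E) : E :=
  match l with
  | nil => vzero
  | e :: l' => vadd (vscal (ip x e) e) (expand l' x)
  end.

(** For orthonormal [l], [expand l] is the orthogonal projection onto the span of [l], so its fixed
    points are exactly that span. *)
Definition expanded_by {E : ipspace} (l : list E) (x : E) : Prop := x = expand l x.

Lemma ip_expand_perp {E : ipspace} {HE : fd_ips E} (l : list E) (x y : E) :
  (forall f, In f l -> ip y f = 0) -> ip (expand l x) y = 0.
Proof.
  induction l as [ | e l IH]; simpl; intro H; ipl; auto.
  rewrite IH, (ip_sym e), H; auto; ring.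
Qed.

Lemma ip_expand_in {E : ipspace} {HE : fd_ips E} (l : list E) (x e : E) :
  ortho l -> In e l -> ip (expand l x) e = ip x e.
Proof.
  induction l as [ | f l IH]; simpl; [ tauto | ].
  intros (H1 & H2 & H3) [<- | He]; ipl.
  - rewrite H1, ip_expand_perp by auto; ring.
  - rewrite H2, IH by auto; ring.
Qed.

Lemma expand_lin {E : ipspace} {HE : fd_ips E} (l : list E) (a b : R) (x y : E) :
  expand l (vadd (vscal a x) (vscal b y)) = vadd (vscal a (expand l x)) (vscal b (expand l y)).
Proof. induction l as [ | e l IH]; simpl; [ | rewrite IH ]; veq. Qed.

Lemma expand_lincomb {E : ipspace} {HE : fd_ips E} (l : list E) (c : list (R * E)) :
  Forall (fun p => expanded_by l (snd p)) c -> expanded_by l (lincomb c).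
Proof.
  intro H; unfold expanded_by in *.
  induction H as [ | [a b] c Hb Hc IH]; simpl in *.
  - replace (@vzero E) with (vadd (vscal 0 (@vzero E)) (vscal 0 (@vzero E))) at 2 by veq.
    rewrite expand_lin; veq.
  - replace (vadd (vscal a b) (lincomb c)) with (vadd (vscal a b) (vscal 1 (lincomb c))) at 2 by veq.
    rewrite expand_lin, <- Hb, <- IH; veq.
Qed.

Lemma gram_schmidt {E : ipspace} {HE : fd_ips E} (bs : list E) :
  exists l, ortho l /\ forall b, In b bs -> expanded_by l b.
Proof.
  induction bs as [ | b bs (l & Ho & Hl)].
  { exists nil; simpl; tauto. }
  set (r := vsub b (expand l b)).
  assert (Hr : forall e, In e l -> ip r e = 0).
  { intros e He; unfold r; ipl; rewrite ip_expand_in by auto; ring. }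
  destruct (Req_dec (norm r) 0) as [H0 | H0].
  - exists l; split; auto; intros x [<- | Hx]; auto.
    apply vsub0_eq, norm_eq0; auto.
  - set (e := vscal (/ norm r) r).
    assert (He : forall f, In f l -> ip e f = 0)
      by (intros f Hf; unfold e; ipl; rewrite Hr by auto; ring).
    exists (e :: l); simpl; repeat split; auto.
    + unfold e; iplr; rewrite <- norm_sq; field; auto.
    (* The projection [expand l b] is orthogonal to the residual [r], hence [<b, e> e = r] and the
       new direction restores exactly what [l] misses of [b]. *)
    + assert (Hbe : ip b r = norm r * norm r).
      { rewrite norm_sq; replace b with (vadd r (expand l b)) at 1 by (unfold r; veq).
        ipl; rewrite (ip_expand_perp l b r) by auto; ring. }
      intros x [<- | Hx]; unfold expanded_by; simpl.
      * replace (vscal (ip b e) e) with r; [ unfold r; veq | ].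
        unfold e; rewrite ip_scalr, Hbe, vscal_vscal.
        replace (/ norm r * (norm r * norm r) * / norm r) with 1 by (field; auto); veq.
      * rewrite (Hl x Hx) at 2; rewrite ip_expand_perp by auto.
        rewrite <- (Hl x Hx); veq.
Qed.

Lemma orthonormal_basis {E : ipspace} {HE : fd_ips E} :
  exists l : list E, ortho l /\ forall x : E, x = expand l x.
Proof.
  pose proof HE as HE'; ips_axioms HE'; destruct Hgen as [bs Hbs].
  destruct (gram_schmidt bs) as (l & Ho & Hl); exists l; split; auto.
  intro x; destruct (Hbs x) as (c & Hc & ->).
  apply expand_lincomb; eapply Forall_impl; [ | exact Hc ]; simpl; auto.
Qed.

(* [k <= s k] replaces strict monotonicity of the extraction [s]; it suffices to preserve limits. *)
Lemma R_bolzano_weierstrass (u : nat -> R) (M : R) :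
  (forall k, Rabs (u k) <= M) ->
  exists (s : nat -> nat) (a : R), (forall k, (k <= s k)%nat) /\ R_cv (fun k => u (s k)) a.
Proof.
  intro HM.
  destruct (Bolzano_Weierstrass u (fun x => -M <= x <= M)) as [a Ha].
  { apply compact_P3. }
  { intro k; specialize (HM k); pose proof (Rle_abs (u k)); pose proof (Rle_abs (- u k)).
    rewrite Rabs_Ropp in *; lra. }
  assert (H : forall k : nat, exists p, (k <= p)%nat /\ Rabs (u p - a) < / (INR k + 1)).
  { intro k; apply (Ha (disc a (mkposreal _ (inv_S_pos k)))).
    exists (mkposreal _ (inv_S_pos k)); intros x Hx; exact Hx. }
  apply functional_choice in H; destruct H as [s Hs].
  exists s, a; split; [ intro; apply Hs | ].
  intros eps He; destruct (R_cv_inv_S eps He) as [N HN]; exists N; intros k Hk.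
  specialize (HN k Hk); destruct (Hs k) as [_ H].
  pose proof (Rle_abs (/ (INR k + 1) - 0)); lra.
Qed.

Lemma bolzano_weierstrass {E : ipspace} {HE : fd_ips E} (u : nat -> E) (M : R) :
  (forall k, norm (u k) <= M) ->
  exists (s : nat -> nat) (a : E), (forall k, (k <= s k)%nat) /\ seq_cv (fun k => u (s k)) a.
Proof.
  intro HM; destruct (@orthonormal_basis E HE) as (l & _ & Hl).
  (* Induction on the basis: the next coordinate is made to converge along a further extraction from
     the subsequence already found. *)
  assert (H : exists (s : nat -> nat) (a : E), (forall k, (k <= s k)%nat) /\
            seq_cv (fun k => expand l (u (s k))) a).
  { clear Hl; induction l as [ | e l (s & a & Hs & Ha)]; simpl.
    - exists (fun k => k), vzero; split; auto using seq_cv_const.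
    - destruct (R_bolzano_weierstrass (fun k => ip (u (s k)) e) (M * norm e)) as (s' & g & Hs' & Hg).
      { intro k; pose proof (cauchy_schwarz_abs (u (s k)) e).
        pose proof (norm_pos e); specialize (HM (s k)); nra. }
      exists (fun k => s (s' k)), (vadd (vscal g e) a); split.
      + intro k; specialize (Hs' k); specialize (Hs (s' k)); lia.
      + apply seq_cv_add.
        * apply seq_cv_scal; auto using seq_cv_const.
        * apply (seq_cv_sub (fun k => expand l (u (s k)))); auto. }
  destruct H as (s & a & Hs & Ha); exists s, a; split; auto.
  apply seq_cv_ext with (2 := Ha); intro k; symmetry; apply Hl.
Qed.

Lemma minimum_exists {E : ipspace} {HE : fd_ips E} (A : E -> Prop) (f : E -> R) (c : E) (M : R) :
  A c -> closed A -> (forall x, A x -> norm x <= M) ->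
  (forall u a, (forall k, A (u k)) -> A a -> seq_cv u a -> R_cv (fun k => f (u k)) (f a)) ->
  exists x, A x /\ forall y, A y -> f x <= f y.
Proof.
  intros HAc Hcl HM Hf.
  (* Otherwise points with [f (u k) < - k] would cluster at a point of [A], where continuity makes
     [f] finite. *)
  assert (Hlow : exists m, forall x, A x -> m <= f x).
  { apply NNPP; intro Hn.
    assert (H : forall k : nat, exists x, A x /\ f x < - INR k).
    { intro k; apply NNPP; intro Hk; apply Hn; exists (- INR k); intros x Hx.
      apply Rnot_lt_le; intro; apply Hk; exists x; auto. }
    apply functional_choice in H; destruct H as [u Hu].
    destruct (bolzano_weierstrass u M) as (s & a & Hs & Ha); [ intro; apply HM, Hu | ].
    assert (HAa : A a) by (apply Hcl with (fun k => u (s k)); auto; intro; apply Hu).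
    destruct (Hf _ _ (fun k => proj1 (Hu (s k))) HAa Ha 1 Rlt_0_1) as [N HN].
    destruct (INR_unbounded (1 - f a)) as [N' HN'].
    specialize (HN (N + N')%nat ltac:(lia)).
    destruct (Hu (s (N + N')%nat)) as [_ H].
    assert (HI : INR N' <= INR (s (N + N')%nat)).
    { apply le_INR; specialize (Hs (N + N')%nat); lia. }
    apply Rabs_def2 in HN; lra. }
  destruct Hlow as [m Hm].
  (* [completeness] delivers suprema, so the infimum of [f] is obtained as [- i]. *)
  destruct (completeness (fun r => exists x, A x /\ r = - f x)) as [i [Hi1 Hi2]].
  { exists (- m); intros r (x & Hx & ->); specialize (Hm x Hx); lra. }
  { exists (- f c), c; auto. }
  assert (H : forall k : nat, exists x, A x /\ f x <= - i + / (INR k + 1)).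
  { intro k; apply NNPP; intro Hk.
    assert (Hb : i <= i - / (INR k + 1)).
    { apply Hi2; intros r (x & Hx & ->); apply Rnot_lt_le; intro.
      apply Hk; exists x; split; auto; lra. }
    pose proof (inv_S_pos k); lra. }
  apply functional_choice in H; destruct H as [u Hu].
  destruct (bolzano_weierstrass u M) as (s & a & Hs & Ha); [ intro; apply HM, Hu | ].
  assert (HAa : A a) by (apply Hcl with (fun k => u (s k)); auto; intro; apply Hu).
  exists a; split; auto; intros y Hy.
  apply Rle_trans with (- i).
  - apply R_cv_le with (fun k => f (u (s k))) (fun k => - i + / (INR (s k) + 1)).
    + intro; apply Hu.
    + apply Hf; auto; intro; apply Hu.
    + replace (- i) with (- i + 0) at 1 by ring; apply R_cv_plus; [ apply R_cv_const | ].
      apply (R_cv_sub (fun k => / (INR k + 1))); auto using R_cv_inv_S.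
  - assert (- f y <= i) by (apply Hi1; exists y; auto); lra.
Qed.

(** Points farther from [z] than a chosen [c0] cannot compete, so the search is confined to a
    compact piece of [C]; there the squared distance, continuous through [ip], is minimised. *)
Lemma projection_exists {E : ipspace} {HE : fd_ips E} (C : E -> Prop) (z : E) :
  closed C -> (exists c, C c) ->
  exists p, C p /\ forall c, C c -> norm (vsub z p) <= norm (vsub z c).
Proof.
  intros Hcl [c0 Hc0].
  destruct (minimum_exists (fun c => C c /\ norm (vsub c z) <= norm (vsub c0 z))
              (fun c => ip (vsub c z) (vsub c z)) c0 (norm (vsub c0 z) + norm z))
    as (p & [Hp Hp'] & Hmin).
  - split; auto; lra.
  - intros u a Hu Ha; split.
    + apply Hcl with u; auto; intro; apply Hu.
    + apply norm_cv_le with u; auto; intro; apply Hu.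
  - intros x [_ Hx]; pose proof (norm_le_sub x z); lra.
  - intros u a _ _ Hu; apply R_cv_ip; apply seq_cv_sub_vec; auto using seq_cv_const.
  - exists p; split; auto; intros c Hc; rewrite (norm_sub_sym z p), (norm_sub_sym z c).
    destruct (Rle_lt_dec (norm (vsub c z)) (norm (vsub c0 z))) as [H | H]; [ | lra ].
    specialize (Hmin c (conj Hc H)).
    apply norm_le_sq; [ apply norm_pos | rewrite norm_sq; auto ].
Qed.

Lemma dist_le_attained {E : ipspace} (C : E -> Prop) (z p : E) (r : R) :
  (forall c, C c -> norm (vsub z p) <= norm (vsub z c)) -> dist_le z C r -> norm (vsub z p) <= r.
Proof.
  intros Hp Hr; apply Rnot_lt_le; intro H.
  destruct (Hr ((norm (vsub z p) - r) / 2)) as (c & Hc & Hn); [ lra | ].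
  specialize (Hp c Hc); lra.
Qed.

(** * Tangent and normal cones *)

#[export] Instance fd_ips_prod {E F : ipspace} {HE : fd_ips E} {HF : fd_ips F} :
  fd_ips (prod_ips E F).
Proof.
  repeat split.
  - intros [] [] []; simpl; f_equal; veq.
  - intros [] []; simpl; f_equal; veq.
  - intros []; simpl; f_equal; veq.
  - intros []; simpl; f_equal; veq.
  - intros ? [] []; simpl; f_equal; veq.
  - intros ? ? []; simpl; f_equal; veq.
  - intros ? ? []; simpl; f_equal; veq.
  - intros []; simpl; f_equal; veq.
  - intros [] []; simpl; rewrite (ip_sym (E := E)), (ip_sym (E := F)); reflexivity.
  - intros ? ? [] [] []; simpl; ipl; ring.
  - intros []; simpl; apply Rplus_le_le_0_compat; apply ip_pos.
  - intros [x y]; simpl; intro H; pose proof (ip_pos x); pose proof (ip_pos y).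
    f_equal; apply ip_def; lra.
  - pose proof HE as HE'; ips_axioms HE'; destruct Hgen as [b1 Hb1].
    (* [clear] frees the names that [ips_axioms] introduces again for the second space. *)
    clear - Hb1 HE HF; pose proof HF as HF'; ips_axioms HF'; destruct Hgen as [b2 Hb2].
    clear - Hb1 Hb2 HE HF.
    exists (map (fun x => (x, vzero)) b1 ++ map (fun y => (vzero, y)) b2); intros [x y].
    destruct (Hb1 x) as (l1 & H1 & ->); destruct (Hb2 y) as (l2 & H2 & ->).
    exists (map (fun p => (fst p, (snd p, vzero))) l1 ++ map (fun p => (fst p, (vzero, snd p))) l2).
    split.
    + apply Forall_app; split; apply Forall_map.
      * eapply Forall_impl; [ | exact H1 ]; simpl; intros p Hp; apply in_or_app; left.
        apply (in_map (fun x => (x, vzero))); auto.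
      * eapply Forall_impl; [ | exact H2 ]; simpl; intros p Hp; apply in_or_app; right.
        apply (in_map (fun x => (vzero, x))); auto.
    + assert (Ha : forall l l' : list (R * prod_ips E F),
        lincomb (l ++ l') = vadd (lincomb l) (lincomb l')).
      { induction l as [ | [a [u v]] l IH]; intro l'; simpl.
        - destruct (lincomb l'); simpl; f_equal; veq.
        - rewrite IH; simpl; f_equal; veq. }
      rewrite Ha.
      replace (@lincomb (prod_ips E F) (map (fun p => (fst p, (snd p, vzero))) l1))
        with ((lincomb l1, vzero) : prod_ips E F).
      2:{ clear - HE HF; induction l1 as [ | [a u] l IH]; simpl; auto.
          rewrite <- IH; simpl; f_equal; veq. }
      replace (@lincomb (prod_ips E F) (map (fun p => (fst p, (vzero, snd p))) l2))
        with ((vzero, lincomb l2) : prod_ips E F).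
      2:{ clear - HE HF; induction l2 as [ | [a u] l IH]; simpl; auto.
          rewrite <- IH; simpl; f_equal; veq. }
      simpl; f_equal; veq.
Qed.

#[export] Instance fd_ips_R : fd_ips R_ips.
Proof.
  repeat split; simpl; intros; try ring.
  - nra.
  - nra.
  - exists [1]; intro x; exists [(x, 1)]; split; simpl; auto; ring.
Qed.

Lemma norm_R (x : R_ips) : norm x = Rabs x.
Proof. unfold norm; simpl; apply sqrt_Rsqr_abs. Qed.

Lemma seq_cv_R (u : nat -> R) (a : R) : @seq_cv R_ips u a <-> R_cv u a.
Proof.
  split; intros H eps He; destruct (H eps He) as [N HN]; exists N; intros k Hk;
    specialize (HN k Hk); rewrite norm_R in *; exact HN.
Qed.

Lemma norm_pair_sq {E F : ipspace} {HE : fd_ips E} {HF : fd_ips F} (p : prod_ips E F) :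
  norm p * norm p = norm (fst p) * norm (fst p) + norm (snd p) * norm (snd p).
Proof. rewrite !norm_sq; reflexivity. Qed.

Lemma norm_fst_le {E F : ipspace} {HE : fd_ips E} {HF : fd_ips F} (p : prod_ips E F) :
  norm (fst p) <= norm p.
Proof.
  pose proof (norm_pair_sq p); pose proof (norm_pos p); pose proof (norm_pos (fst p)).
  pose proof (norm_pos (snd p)); nra.
Qed.

Lemma norm_snd_le {E F : ipspace} {HE : fd_ips E} {HF : fd_ips F} (p : prod_ips E F) :
  norm (snd p) <= norm p.
Proof.
  pose proof (norm_pair_sq p); pose proof (norm_pos p); pose proof (norm_pos (fst p)).
  pose proof (norm_pos (snd p)); nra.
Qed.

Lemma norm_pair_le {E F : ipspace} {HE : fd_ips E} {HF : fd_ips F} (p : prod_ips E F) :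
  norm p <= norm (fst p) + norm (snd p).
Proof.
  pose proof (norm_pair_sq p); pose proof (norm_pos p); pose proof (norm_pos (fst p)).
  pose proof (norm_pos (snd p)); nra.
Qed.

Lemma seq_cv_fst {E F : ipspace} {HE : fd_ips E} {HF : fd_ips F} (u : nat -> prod_ips E F) a :
  seq_cv u a -> seq_cv (fun k => fst (u k)) (fst a).
Proof.
  intros H eps He; destruct (H eps He) as [N HN]; exists N; intros k Hk.
  eapply Rle_lt_trans; [ apply (norm_fst_le (vsub (u k) a)) | auto ].
Qed.

Lemma seq_cv_snd {E F : ipspace} {HE : fd_ips E} {HF : fd_ips F} (u : nat -> prod_ips E F) a :
  seq_cv u a -> seq_cv (fun k => snd (u k)) (snd a).
Proof.
  intros H eps He; destruct (H eps He) as [N HN]; exists N; intros k Hk.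
  eapply Rle_lt_trans; [ apply (norm_snd_le (vsub (u k) a)) | auto ].
Qed.

(** One-sided first-order condition for quadratic expansions; it stands in for a derivative at a
    minimum. *)
Lemma first_order_nonneg (a b del : R) :
  0 < del -> (forall t, 0 < t <= del -> 0 <= a * t + b * (t * t)) -> 0 <= a.
Proof.
  intros Hdel H; apply Rnot_lt_le; intro Ha.
  (* Small enough that [|b| t <= - a / 2], so the linear term dominates. *)
  set (t := Rmin del (- a / (2 * (Rabs b + 1)))).
  pose proof (Rabs_pos b) as Hb; pose proof (Rle_abs b) as Hb'.
  assert (Ht : 0 < - a / (2 * (Rabs b + 1))) by (apply Rdiv_lt_0_compat; lra).
  assert (Ht1 : 0 < t) by (apply Rmin_glb_lt; auto).
  assert (Ht2 : t <= del) by apply Rmin_l.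
  assert (Ht3 : t <= - a / (2 * (Rabs b + 1))) by apply Rmin_r.
  assert (Ht4 : t * (2 * (Rabs b + 1)) <= - a).
  { replace (- a) with (- a / (2 * (Rabs b + 1)) * (2 * (Rabs b + 1))) by (field; lra).
    apply Rmult_le_compat_r; lra. }
  specialize (H t (conj Ht1 Ht2)); nra.
Qed.

Lemma R_cv_eventually_le (u v : nat -> R) a b :
  (exists N, forall k, (N <= k)%nat -> u k <= v k) -> R_cv u a -> R_cv v b -> a <= b.
Proof.
  intros [N HN] Hu Hv.
  apply R_cv_le with (fun k => u (N + k)%nat) (fun k => v (N + k)%nat).
  - intro; apply HN; lia.
  - apply (R_cv_sub u a (fun k => (N + k)%nat)); auto; intro; lia.
  - apply (R_cv_sub v b (fun k => (N + k)%nat)); auto; intro; lia.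
Qed.

(** Comparing [c] with [c + t v] in [C] leaves [2 <z - c, v> <= t |v|^2], whose right side vanishes
    along a tangent sequence. *)
Lemma proximal_normal {Z : ipspace} {HZ : fd_ips Z} (C : Z -> Prop) (z c : Z) (rho a : R) :
  0 < rho -> 0 <= a ->
  (forall c', C c' -> norm (vsub c' c) <= rho ->
     ip (vsub z c) (vsub z c) <= ip (vsub z c') (vsub z c')) ->
  regular_normal C c (vscal a (vsub z c)).
Proof.
  intros Hrho Ha Hmin u (t & v & [Ht Ht0] & Hv & HC).
  assert (H : ip (vsub z c) u <= 0 * ip u u).
  { apply R_cv_eventually_le with (fun k => ip (vsub z c) (v k)) (fun k => t k * ip (v k) (v k)).
    - destruct (seq_cv_scal _ _ _ _ Ht0 Hv rho Hrho) as [N HN]; exists N; intros k Hk.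
      specialize (HN k Hk); specialize (Ht k).
      replace (vsub (vscal (t k) (v k)) (vscal 0 u))
        with (vsub (vadd c (vscal (t k) (v k))) c) in HN by veq.
      pose proof (Hmin _ (HC k) (Rlt_le _ _ HN)) as H.
      replace (vsub z (vadd c (vscal (t k) (v k))))
        with (vsub (vsub z c) (vscal (t k) (v k))) in H by veq.
      set (w := vsub z c) in *; revert H; iplr; intro H; rewrite (ip_sym (v k) w) in H.
      pose proof (ip_pos (v k)); apply Rmult_le_reg_l with (2 * t k); [ lra | nra ].
    - apply R_cv_ip; auto using seq_cv_const.
    - apply R_cv_mult; auto; apply R_cv_ip; auto. }
  rewrite ip_scall; nra.
Qed.

(** Serves two penalties: over [R_ips] for the growth of a distance along a segment, and over the
    decision space for the multipliers. The radius [rad] makes the search over [C] compact. *)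
Lemma penalty_minimum {X Z : ipspace} {HX : fd_ips X} {HZ : fd_ips Z}
  (P : X -> Prop) (p0 : X) (M : R) (f : X -> R) (G : X -> Z) (C : Z -> Prop) (y : Z) (rad k : R) :
  P p0 -> closed P -> (forall p, P p -> norm p <= M) ->
  closed C -> C y -> 0 <= rad ->
  (forall u a, seq_cv u a -> R_cv (fun i => f (u i)) (f a)) ->
  (forall u a, seq_cv u a -> seq_cv (fun i => G (u i)) (G a)) ->
  exists p c, P p /\ C c /\ norm (vsub c y) <= rad /\
    forall p' c', P p' -> C c' -> norm (vsub c' y) <= rad ->
      f p + k * ip (vsub (G p) c) (vsub (G p) c) <=
      f p' + k * ip (vsub (G p') c') (vsub (G p') c').
Proof.
  intros Hp0 HP HM HC Hy Hrad Hf HG.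
  destruct (@minimum_exists (prod_ips X Z) _
     (fun q => P (fst q) /\ C (snd q) /\ norm (vsub (snd q) y) <= rad)
     (fun q => f (fst q) + k * ip (vsub (G (fst q)) (snd q)) (vsub (G (fst q)) (snd q)))
     (p0, y) (M + (norm y + rad))) as ([p c] & (H1 & H2 & H3) & H4).
  - simpl; rewrite vsub_diag, norm_zero; auto.
  - intros u a Hu Ha; pose proof (seq_cv_fst _ _ Ha); pose proof (seq_cv_snd _ _ Ha).
    split; [ | split ].
    + apply HP with (fun i => fst (u i)); auto; intro; apply Hu.
    + apply HC with (fun i => snd (u i)); auto; intro; apply Hu.
    + apply norm_cv_le with (fun i => snd (u i)); auto; intro; apply Hu.
  - intros [p c] (H1 & H2 & H3); simpl in *.
    pose proof (norm_pair_le ((p, c) : prod_ips X Z)) as H; simpl in H.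
    pose proof (norm_le_sub c y); specialize (HM p H1); lra.
  - intros u a _ _ Ha; pose proof (seq_cv_fst _ _ Ha) as H1; pose proof (seq_cv_snd _ _ Ha) as H2.
    apply R_cv_plus; [ apply (Hf _ _ H1) | ].
    apply R_cv_scal, R_cv_ip; apply seq_cv_sub_vec; auto.
  - exists p, c; repeat split; auto; intros p' c' Hp' Hc' Hr.
    exact (H4 (p', c') (conj Hp' (conj Hc' Hr))).
Qed.

(* A mean value inequality for the distance to [C] along [s |-> y + s u]: the normal is
   the scaled residual at a minimiser of [|y + s u - c|^2 / (eps t) - eps s / 2]. *)
Lemma normal_of_distance_growth {Z : ipspace} {HZ : fd_ips Z} (C : Z -> Prop) (y u : Z) (t eps : R) :
  closed C -> C y -> 0 < t -> 0 < eps ->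
  (forall c, C c -> eps * t <= norm (vsub (vadd y (vscal t u)) c)) ->
  exists c lam, C c /\ norm (vsub c y) <= t * (norm u + eps) /\
    regular_normal C c lam /\ norm lam <= 2 /\ eps / 2 <= ip lam u.
Proof.
  intros HC Hy Ht Heps Hfar.
  assert (Het : 0 < eps * t) by (apply Rmult_lt_0_compat; auto).
  (* With this weight, comparison with [s = 0], [c = y] gives [|z|^2 <= (eps t)^2 / 2] for the
     residual [z]. This bounds the normal [2 k z] by [2] and excludes [s = t], where the distance to
     [C] is at least [eps t]. *)
  set (k := / (eps * t)).
  assert (Hk : 0 < k) by (apply Rinv_0_lt_compat; auto).
  assert (Hket : k * (eps * t) = 1) by (unfold k; field; lra).
  pose proof (norm_pos u) as Hu.
  (* The [+ 1] in the radius keeps the ball constraint inactive: the minimising [c] lies within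
     [t * (norm u + eps)] of [y], so all points of [C] within [1] of [c] are competitors. *)
  destruct (@penalty_minimum R_ips Z _ _ (fun s => 0 <= s <= t) 0 t
    (fun s => - (eps / 2) * s) (fun s => vadd y (vscal s u)) C y (t * (norm u + eps) + 1) k)
    as (s & c & Hs & Hc & Hrad & Hmin); auto.
  - lra.
  - intros v a Hv Ha; apply seq_cv_R in Ha; split.
    + apply R_cv_le with (fun _ => 0) v; auto using R_cv_const; intro; apply Hv.
    + apply R_cv_le with v (fun _ => t); auto using R_cv_const; intro; apply Hv.
  - intros s Hs; rewrite norm_R, Rabs_pos_eq; lra.
  - nra.
  - intros v a Ha; apply seq_cv_R in Ha; apply R_cv_scal; auto.
  - intros v a Ha; apply seq_cv_R in Ha; apply seq_cv_add; auto using seq_cv_const.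
    apply seq_cv_scal; auto using seq_cv_const.
  - set (z := vsub (vadd y (vscal s u)) c) in *.
    assert (H0 : - (eps / 2) * s + k * ip z z <= 0).
    { replace 0 with (- (eps / 2) * 0 +
        k * ip (vsub (vadd y (vscal 0 u)) y) (vsub (vadd y (vscal 0 u)) y)) by (iplr; ring).
      apply Hmin; auto; [ lra | rewrite vsub_diag, norm_zero; nra ]. }
    assert (Hq : ip z z <= (eps * t) * (eps * t) / 2).
    { apply Rmult_le_reg_l with k; auto.
      replace (k * (eps * t * (eps * t) / 2)) with ((k * (eps * t)) * (eps * t) / 2) by field.
      rewrite Hket; nra. }
    assert (Hz : norm z <= eps * t) by (apply norm_le_sq; nra).
    assert (Hcy : norm (vsub c y) <= t * (norm u + eps)).
    { replace (vsub c y) with (vsub (vscal s u) z) by (unfold z; veq).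
      pose proof (norm_sub_add (vscal s u) z) as H; rewrite norm_scal_pos in H by lra; nra. }
    assert (Hst : s < t).
    { destruct (Rle_lt_or_eq_dec s t) as [ | ->]; try lra; exfalso.
      specialize (Hfar c Hc); fold z in Hfar; rewrite <- norm_sq in Hq; nra. }
    exists c, (vscal (2 * k) z); repeat split; auto.
    + apply proximal_normal with 1; try lra.
      intros c' Hc' Hn; apply Rmult_le_reg_l with k; auto.
      apply Rplus_le_reg_l with (- (eps / 2) * s); apply Hmin; auto.
      pose proof (norm_sub_triangle c c' y); lra.
    + rewrite norm_scal_pos by lra; nra.
    + rewrite ip_scall.
      (* This is the right derivative in [s] of the penalised function; [s < t] makes forward moves
         admissible. *)
      enough (0 <= 2 * k * ip z u - eps / 2) by lra.
      apply first_order_nonneg with (k * ip u u) (t - s); [ lra | ].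
      intros tau Htau; specialize (Hmin (s + tau) c ltac:(lra) Hc Hrad).
      replace (vsub (vadd y (vscal (s + tau) u)) c)
        with (vadd z (vscal tau u)) in Hmin by (unfold z; veq).
      revert Hmin; unfold vsub; rewrite !ip_addl, !ip_addr, !ip_scall, !ip_scalr, (ip_sym u z); lra.
Qed.

(** Take for [v_k] the quotient [(p_k - y_k) / t_k] with [p_k] nearest to [y_k + t_k u], so that
    [t_k |v_k - u|] is the distance of [y_k + t_k u] to [C]. If [v_k] does not tend to [u], this
    distance is at least [eps t_k] infinitely often; the resulting normals are bounded by [2], sit
    at points tending to [y], and cluster at a limiting normal [nu] with [<nu, u> >= eps / 2]. *)
Lemma polar_limiting_normal_clarke {Z : ipspace} {HZ : fd_ips Z} (C : Z -> Prop) (y u : Z) :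
  closed C -> (forall nu, limiting_normal C y nu -> ip nu u <= 0) -> clarke_tangent C y u.
Proof.
  intros HC Hpol t yk [Ht Ht0] Hyk Hcv.
  assert (H : forall k, exists p, C p /\
    forall c, C c -> norm (vsub (vadd (yk k) (vscal (t k) u)) p)
                     <= norm (vsub (vadd (yk k) (vscal (t k) u)) c)).
  { intro k; apply projection_exists; auto; exists (yk k); auto. }
  apply functional_choice in H; destruct H as [p Hp].
  exists (fun k => vscal (/ t k) (vsub (p k) (yk k))); split.
  2:{ intro k; specialize (Ht k).
      replace (vadd (yk k) (vscal (t k) (vscal (/ t k) (vsub (p k) (yk k))))) with (p k).
      - apply Hp.
      - rewrite vscal_vscal, Rinv_r by lra; veq. }
  apply NNPP; intro Hn.
  unfold seq_cv in Hn; apply not_all_ex_not in Hn; destruct Hn as [eps Hn].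
  apply imply_to_and in Hn; destruct Hn as [Heps Hn].
  assert (H : forall N : nat, exists q : nat * (Z * Z), (N <= fst q)%nat /\
     C (fst (snd q)) /\ norm (vsub (fst (snd q)) (yk (fst q))) <= t (fst q) * (norm u + eps) /\
     regular_normal C (fst (snd q)) (snd (snd q)) /\ norm (snd (snd q)) <= 2 /\
     eps / 2 <= ip (snd (snd q)) u).
  { intro N; apply NNPP; intro HN; apply Hn; exists N; intros k Hk.
    apply Rnot_le_lt; intro Hle; apply HN.
    destruct (normal_of_distance_growth C (yk k) u (t k) eps) as (c & lam & H); auto.
    - intros c Hc; eapply Rle_trans; [ | apply (proj2 (Hp k) c Hc) ].
      specialize (Ht k).
      replace (vsub (vadd (yk k) (vscal (t k) u)) (p k)) with
        (vscal (- t k) (vsub (vscal (/ t k) (vsub (p k) (yk k))) u)).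
      + rewrite norm_scal, Rabs_Ropp, Rabs_pos_eq by lra; nra.
      + apply ip_ext; intro e; ipl; field; lra.
    - exists (k, (c, lam)); simpl; auto. }
  apply functional_choice in H; destruct H as [q Hq].
  destruct (bolzano_weierstrass (fun N => snd (snd (q N))) 2) as (s & nu & Hs & Hnu).
  { intro N; apply (Hq N). }
  assert (Hc : seq_cv (fun N => fst (snd (q N))) y).
  { apply seq_cv_bound with
      (fun N => t (fst (q N)) * (norm u + eps) + norm (vsub (yk (fst (q N))) y)).
    - exists 0%nat; intros N _; destruct (Hq N) as (_ & _ & H & _).
      pose proof (norm_sub_triangle (yk (fst (q N))) (fst (snd (q N))) y); lra.
    - replace 0 with (0 * (norm u + eps) + 0) by ring.
      assert (Hfst : forall N, (N <= fst (q N))%nat) by (intro; apply Hq).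
      apply R_cv_plus.
      + apply R_cv_mult; auto using R_cv_const; apply (R_cv_sub t 0 (fun N => fst (q N))); auto.
      + apply seq_cv_norm in Hcv.
        apply (R_cv_sub (fun k => norm (vsub (yk k) y)) 0 (fun N => fst (q N))); auto. }
  assert (Hlim : limiting_normal C y nu).
  { exists (fun N => fst (snd (q (s N)))), (fun N => snd (snd (q (s N)))).
    repeat split; auto; try (intro; apply Hq).
    apply (seq_cv_sub (fun N => fst (snd (q N)))); auto. }
  assert (eps / 2 <= ip nu u); [ | specialize (Hpol nu Hlim); lra ].
  apply R_cv_le with (fun _ => eps / 2) (fun N => ip (snd (snd (q (s N)))) u).
  - intro; apply Hq.
  - apply R_cv_const.
  - apply R_cv_ip; auto using seq_cv_const.
Qed.

(** * Clarke normals and the polar of the Clarke tangent cone *)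

Lemma limiting_normal_scal {Z : ipspace} {HZ : fd_ips Z} (C : Z -> Prop) (y v : Z) (a : R) :
  0 <= a -> limiting_normal C y v -> limiting_normal C y (vscal a v).
Proof.
  intros Ha (yk & vk & H1 & H2 & H3 & H4); exists yk, (fun k => vscal a (vk k)).
  repeat split; auto.
  - apply seq_cv_scal; auto using R_cv_const.
  - intros k u Hu; specialize (H4 k u Hu); rewrite ip_scall; nra.
Qed.

Lemma limiting_normal_zero {Z : ipspace} {HZ : fd_ips Z} (C : Z -> Prop) (y : Z) :
  C y -> limiting_normal C y vzero.
Proof.
  intro Hy; exists (fun _ => y), (fun _ => vzero); repeat split; auto using seq_cv_const.
  intros k u _; rewrite ip_zerol; lra.
Qed.

Lemma closed_closure {E : ipspace} {HE : fd_ips E} (A : E -> Prop) : closed (closure A).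
Proof.
  intros u a Hu Ha eps Heps.
  destruct (Ha (eps / 2)) as [N HN]; [ lra | ].
  destruct (Hu N (eps / 2)) as (b & Hb & Hn); [ lra | ].
  exists b; split; auto; specialize (HN N (Nat.le_refl N)); rewrite norm_sub_sym in HN.
  pose proof (norm_sub_triangle (u N) a b); lra.
Qed.

Lemma closure_map {E : ipspace} {HE : fd_ips E} (A : E -> Prop) (g : E -> E) (M : R) :
  0 < M -> (forall x y, norm (vsub (g x) (g y)) <= M * norm (vsub x y)) ->
  (forall x, A x -> A (g x)) -> forall x, closure A x -> closure A (g x).
Proof.
  intros HM Hg HA x Hx eps Heps.
  destruct (Hx (eps / M)) as (a & Ha & Hn); [ apply Rdiv_lt_0_compat; auto | ].
  exists (g a); split; auto; eapply Rle_lt_trans; [ apply Hg | ].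
  replace eps with (M * (eps / M)) by (field; lra); apply Rmult_lt_compat_l; auto.
Qed.

Lemma lincomb_rescale {E : ipspace} {HE : fd_ips E} (l : list (R * E)) (c a : R) :
  lincomb (map (fun p => (c * fst p, vscal a (snd p))) l) = vscal (c * a) (lincomb l) /\
  coefsum (map (fun p => (c * fst p, vscal a (snd p))) l) = c * coefsum l.
Proof.
  induction l as [ | [b x] l [IH1 IH2]]; simpl; split.
  - veq.
  - ring.
  - rewrite IH1; veq.
  - rewrite IH2; ring.
Qed.

Lemma conv_hull_cone_scal {E : ipspace} {HE : fd_ips E} (A : E -> Prop) (a : R) (x : E) :
  (forall v, A v -> A (vscal a v)) -> conv_hull A x -> conv_hull A (vscal a x).
Proof.
  intros HA (l & H1 & H2 & ->).
  destruct (lincomb_rescale l 1 a) as [H3 H4].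
  exists (map (fun p => (1 * fst p, vscal a (snd p))) l); repeat split.
  - apply Forall_map; eapply Forall_impl; [ | exact H1 ]; simpl; intros p []; split; auto; lra.
  - rewrite H4, H2; ring.
  - rewrite H3; veq.
Qed.

(** [x + v] is the midpoint of [2 x] and [2 v], and doubling can be carried out on the vectors of
    [A] with the weights kept. *)
Lemma conv_hull_cone_add {E : ipspace} {HE : fd_ips E} (A : E -> Prop) (x v : E) :
  (forall w, A w -> A (vscal 2 w)) -> A v -> conv_hull A x -> conv_hull A (vadd x v).
Proof.
  intros HA Hv (l & H1 & H2 & ->).
  destruct (lincomb_rescale l (/ 2) 2) as [H3 H4].
  exists ((/ 2, vscal 2 v) :: map (fun p => (/ 2 * fst p, vscal 2 (snd p))) l); repeat split.
  - constructor; simpl; [ split; auto; lra | ].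
    apply Forall_map; eapply Forall_impl; [ | exact H1 ]; simpl; intros p []; split; auto; lra.
  - simpl; rewrite H4, H2; field.
  - simpl; rewrite H3; apply ip_ext; intro e; ipl; field.
Qed.

Lemma clarke_normal_scal {Z : ipspace} {HZ : fd_ips Z} (C : Z -> Prop) (y v : Z) (a : R) :
  0 < a -> clarke_normal C y v -> clarke_normal C y (vscal a v).
Proof.
  intros Ha; unfold clarke_normal.
  apply (closure_map _ (vscal a) a); auto.
  - intros x x'; replace (vsub (vscal a x) (vscal a x')) with (vscal a (vsub x x')) by veq.
    rewrite norm_scal_pos; lra.
  - intros x; apply conv_hull_cone_scal; intros; apply limiting_normal_scal; auto; lra.
Qed.

Lemma clarke_normal_add {Z : ipspace} {HZ : fd_ips Z} (C : Z -> Prop) (y v w : Z) :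
  limiting_normal C y w -> clarke_normal C y v -> clarke_normal C y (vadd v w).
Proof.
  intros Hw; unfold clarke_normal.
  apply (closure_map _ (fun v => vadd v w) 1); [ lra | | ].
  - intros x x'; replace (vsub (vadd x w) (vadd x' w)) with (vsub x x') by veq; lra.
  - intros x; apply conv_hull_cone_add; auto; intros; apply limiting_normal_scal; auto; lra.
Qed.

Lemma limiting_clarke_normal {Z : ipspace} {HZ : fd_ips Z} (C : Z -> Prop) (y v : Z) :
  limiting_normal C y v -> clarke_normal C y v.
Proof.
  intros Hv eps Heps; exists v; split.
  - exists [(1, v)]; repeat split; [ repeat constructor; simpl; auto; lra | simpl; ring | simpl; veq ].
  - rewrite vsub_diag, norm_zero; auto.
Qed.

(** Project [m] to [q] in the Clarke normal cone and let [u = m - q]. Moving [q] along limiting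
    normals shows that [u] is polar to them, hence a Clarke tangent, so [<m, u> <= 0]. Shrinking [q]
    gives [<q, u> >= 0], and [<m, u> = |u|^2 + <q, u>] forces [u = 0]. *)
Lemma polar_clarke_tangent_normal {Z : ipspace} {HZ : fd_ips Z} (C : Z -> Prop) (y m : Z) :
  closed C -> C y -> (forall u, clarke_tangent C y u -> ip m u <= 0) -> clarke_normal C y m.
Proof.
  intros HC Hy Hpol.
  destruct (projection_exists (clarke_normal C y) m) as (q & Hq & Hmin).
  { apply closed_closure. }
  { exists vzero; apply limiting_clarke_normal, limiting_normal_zero; auto. }
  set (u := vsub m q).
  (* First-order optimality of the projection. The bound [/ 2] keeps [1 - tau] positive when [q] is
     shrunk. *)
  assert (Hdir : forall w, (forall tau, 0 < tau <= / 2 -> clarke_normal C y (vadd q (vscal tau w))) ->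
     ip u w <= 0).
  { intros w Hw; enough (0 <= - ip u w) by lra.
    apply first_order_nonneg with (ip w w / 2) (/ 2); [ lra | ].
    intros tau Htau; specialize (Hmin _ (Hw tau Htau)).
    replace (vsub m (vadd q (vscal tau w))) with (vsub u (vscal tau w)) in Hmin by (unfold u; veq).
    fold u in Hmin.
    assert (H : ip u u <= ip (vsub u (vscal tau w)) (vsub u (vscal tau w))).
    { rewrite <- !norm_sq; pose proof (norm_pos u); nra. }
    revert H; unfold vsub; rewrite !ip_addl, !ip_addr, !ip_oppl, !ip_oppr, !ip_scall, !ip_scalr,
      (ip_sym w u); lra. }
  assert (Hu : clarke_tangent C y u).
  { apply polar_limiting_normal_clarke; auto; intros nu Hnu; rewrite ip_sym; apply Hdir.
    intros tau Htau; apply clarke_normal_add; auto; apply limiting_normal_scal; auto; lra. }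
  assert (Hqu : ip u (vopp q) <= 0).
  { apply Hdir; intros tau Htau.
    replace (vadd q (vscal tau (vopp q))) with (vscal (1 - tau) q) by veq.
    apply clarke_normal_scal; auto; lra. }
  specialize (Hpol u Hu).
  replace m with q; auto; symmetry; apply vsub0_eq; fold u; apply ip_def.
  pose proof (ip_pos u); rewrite ip_oppr in Hqu.
  replace (ip m u) with (ip u u + ip u q) in Hpol; [ lra | ].
  rewrite (ip_sym u q); unfold u at 1; ipl; ring.
Qed.

(** * Clarke tangents as a convex cone and as translations of second-order tangents *)

Lemma clarke_tangent_zero {Z : ipspace} {HZ : fd_ips Z} (C : Z -> Prop) (y : Z) :
  clarke_tangent C y vzero.
Proof.
  intros t yk Ht Hyk Hcv; exists (fun _ => vzero); split; auto using seq_cv_const.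
  intro k; replace (vadd (yk k) (vscal (t k) vzero)) with (yk k) by veq; auto.
Qed.

Lemma clarke_tangent_scal {Z : ipspace} {HZ : fd_ips Z} (C : Z -> Prop) (y u : Z) (a : R) :
  0 <= a -> clarke_tangent C y u -> clarke_tangent C y (vscal a u).
Proof.
  intros Ha Hu.
  (* The general case feeds the steps [a t_k] to the definition, and these must be positive. *)
  destruct (Req_dec a 0) as [-> | Ha0]; [ rewrite vscal0; apply clarke_tangent_zero | ].
  intros t yk [Ht Ht0] Hyk Hcv.
  destruct (Hu (fun k => a * t k) yk) as (v & Hv & HC); auto.
  - split; [ intro k; specialize (Ht k); nra | ].
    replace 0 with (a * 0) by ring; apply R_cv_scal; auto.
  - exists (fun k => vscal a (v k)); split; [ apply seq_cv_scal; auto using R_cv_const | ].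
    intro k; replace (vadd (yk k) (vscal (t k) (vscal a (v k))))
      with (vadd (yk k) (vscal (a * t k) (v k))) by veq; auto.
Qed.

(** Tangency of [v] is used at the moved base points [y_k + t_k u_k], which lie in [C] and still
    tend to [y]. *)
Lemma clarke_tangent_add {Z : ipspace} {HZ : fd_ips Z} (C : Z -> Prop) (y u v : Z) :
  clarke_tangent C y u -> clarke_tangent C y v -> clarke_tangent C y (vadd u v).
Proof.
  intros Hu Hv t yk [Ht Ht0] Hyk Hcv.
  destruct (Hu t yk) as (uk & Huk & HC); auto; [ split; auto | ].
  destruct (Hv t (fun k => vadd (yk k) (vscal (t k) (uk k)))) as (vk & Hvk & HC'); auto.
  - split; auto.
  - replace y with (vadd y (vscal 0 u)) by veq.
    apply seq_cv_add; auto; apply seq_cv_scal; auto.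
  - exists (fun k => vadd (uk k) (vk k)); split; [ apply seq_cv_add; auto | ].
    intro k; replace (vadd (yk k) (vscal (t k) (vadd (uk k) (vk k)))) with
      (vadd (vadd (yk k) (vscal (t k) (uk k))) (vscal (t k) (vk k))) by veq; auto.
Qed.

Lemma so_path_cv {Z : ipspace} {HZ : fd_ips Z} (y v w : Z) (t : nat -> R) :
  R_cv t 0 -> seq_cv (fun k => so_path y v w (t k)) y.
Proof.
  intro Ht; unfold so_path.
  set (z := vadd y (vadd (vscal 0 v) (vscal (/ 2 * (0 * 0)) w))).
  replace (seq_cv _ y) with
    (seq_cv (fun k => vadd y (vadd (vscal (t k) v) (vscal (/ 2 * (t k * t k)) w))) z)
    by (f_equal; unfold z; veq).
  apply seq_cv_add; auto using seq_cv_const.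
  apply seq_cv_add; apply seq_cv_scal; auto using seq_cv_const.
  apply R_cv_scal, R_cv_mult; auto.
Qed.

(** The points of [C] nearest to the parabola are at distance [o(t_k^2)] and tend to [y]. Clarke
    tangency at these base points with steps [t_k^2 / 2], the weight of [w] in the parabola, moves
    them by about [t_k^2 / 2] times [u] inside [C]. *)
Lemma outer_so_tangent_add_clarke {Z : ipspace} {HZ : fd_ips Z} (C : Z -> Prop) (y v w u : Z) :
  closed C -> C y -> outer_so_tangent C y v w -> clarke_tangent C y u ->
  outer_so_tangent C y v (vadd w u).
Proof.
  intros HC Hy (t & [Ht Ht0] & Hw) Hu.
  assert (H : forall k, exists p, C p /\
    forall c, C c -> norm (vsub (so_path y v w (t k)) p) <= norm (vsub (so_path y v w (t k)) c)).
  { intro k; apply projection_exists; auto; exists y; auto. }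
  apply functional_choice in H; destruct H as [p Hp].
  assert (Hp0 : forall eps, 0 < eps -> exists N, forall k, (N <= k)%nat ->
     norm (vsub (so_path y v w (t k)) (p k)) <= eps * (t k * t k)).
  { intros eps Heps; destruct (Hw eps Heps) as [N HN]; exists N; intros k Hk.
    apply (dist_le_attained C); [ apply Hp | auto ]. }
  assert (Hpy : seq_cv p y).
  { apply seq_cv_bound with (fun k => 1 * (t k * t k) + norm (vsub (so_path y v w (t k)) y)).
    - destruct (Hp0 1 Rlt_0_1) as [N HN]; exists N; intros k Hk; specialize (HN k Hk).
      rewrite norm_sub_sym in HN.
      pose proof (norm_sub_triangle (so_path y v w (t k)) (p k) y); lra.
    - replace 0 with (1 * (0 * 0) + 0) by ring.
      apply R_cv_plus; [ apply R_cv_scal, R_cv_mult; auto | ].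
      apply seq_cv_norm, so_path_cv; auto. }
  destruct (Hu (fun k => / 2 * (t k * t k)) p) as (uk & Huk & HCu); auto.
  { split; [ intro k; specialize (Ht k); nra | ].
    replace 0 with (/ 2 * (0 * 0)) by ring; apply R_cv_scal, R_cv_mult; auto. }
  { intro; apply Hp. }
  exists t; split; [ split; auto | ].
  intros eps Heps.
  destruct (Hp0 (eps / 2)) as [N1 HN1]; [ lra | ].
  destruct (Huk eps Heps) as [N2 HN2].
  exists (N1 + N2)%nat; intros k Hk eta Heta.
  specialize (HN1 k ltac:(lia)); specialize (HN2 k ltac:(lia)); specialize (Ht k).
  exists (vadd (p k) (vscal (/ 2 * (t k * t k)) (uk k))); split; auto.
  replace (vsub (so_path y v (vadd w u) (t k)) (vadd (p k) (vscal (/ 2 * (t k * t k)) (uk k))))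
    with (vsub (vsub (so_path y v w (t k)) (p k)) (vscal (/ 2 * (t k * t k)) (vsub (uk k) u)))
    by (unfold so_path; veq).
  eapply Rle_trans; [ apply norm_sub_add | ].
  assert (0 < t k * t k) by nra.
  rewrite norm_scal_pos by nra; nra.
Qed.

(** * Differential calculus *)

Lemma le_of_le_add_small (a b c del : R) :
  0 < del -> (forall t, 0 < t <= del -> a <= b + c * t) -> a <= b.
Proof.
  intros Hdel H; enough (0 <= b - a) by lra.
  apply first_order_nonneg with c del; auto; intros t Ht; specialize (H t Ht); nra.
Qed.

(** Carries the scalar mean value theorem to vector-valued maps: an error [e] is tested against
    itself, and [r] is the remainder at the intermediate point. *)
Lemma norm_le_of_self_ip {E : ipspace} {HE : fd_ips E} (e r : E) (a : R) :
  norm e * norm e = ip e r -> norm r <= a -> norm e <= a.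
Proof.
  intros He Hr; apply Rle_trans with (norm r); auto.
  pose proof (cauchy_schwarz e r); pose proof (norm_pos e); pose proof (norm_pos r).
  destruct (Req_dec (norm e) 0); [ lra | ].
  apply Rmult_le_reg_l with (norm e); lra.
Qed.

Lemma linear_add {E F : ipspace} {HE : fd_ips E} {HF : fd_ips F} (L : E -> F) (x y : E) :
  is_linear L -> L (vadd x y) = vadd (L x) (L y).
Proof.
  intro H; specialize (H 1 1 x y); rewrite !vscal1 in H; exact H.
Qed.

Lemma linear_zero {E F : ipspace} {HE : fd_ips E} {HF : fd_ips F} (L : E -> F) :
  is_linear L -> L vzero = vzero.
Proof.
  intro H; specialize (H 0 0 vzero vzero); rewrite !vscal0 in H.
  rewrite !vadd_zero in H; exact H.
Qed.

Lemma linear_scal {E F : ipspace} {HE : fd_ips E} {HF : fd_ips F} (L : E -> F) (a : R) (x : E) :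
  is_linear L -> L (vscal a x) = vscal a (L x).
Proof.
  intro H; pose proof (H a 0 x x) as H'; rewrite !vscal0, !vadd_zero in H'; exact H'.
Qed.

Lemma linear_bounded {E F : ipspace} {HE : fd_ips E} {HF : fd_ips F} (L : E -> F) :
  is_linear L -> exists M, 0 <= M /\ forall x, norm (L x) <= M * norm x.
Proof.
  intro HL; destruct (@orthonormal_basis E HE) as (l & _ & Hl).
  assert (H : exists M, 0 <= M /\ forall x, norm (L (expand l x)) <= M * norm x).
  { clear Hl; induction l as [ | e l (M & HM & HlM)]; simpl.
    - exists 0; split; [ lra | ]; intro x; rewrite linear_zero, norm_zero; auto; lra.
    - exists (norm e * norm (L e) + M); pose proof (norm_pos e); pose proof (norm_pos (L e)).
      split; [ nra | ]; intro x; rewrite linear_add, linear_scal by auto.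
      eapply Rle_trans; [ apply norm_triangle | ]; rewrite norm_scal.
      specialize (HlM x); pose proof (cauchy_schwarz_abs x e); nra. }
  destruct H as (M & HM & H); exists M; split; auto; intro x; specialize (H x).
  rewrite <- Hl in H; exact H.
Qed.

Lemma bilinear_bounded {E F : ipspace} {HE : fd_ips E} {HF : fd_ips F} (B : E -> E -> F) :
  (forall h, is_linear (B h)) -> (forall u, is_linear (fun h => B h u)) ->
  exists M, 0 <= M /\ forall h u, norm (B h u) <= M * norm h * norm u.
Proof.
  intros HB1 HB2; destruct (@orthonormal_basis E HE) as (l & _ & Hl).
  assert (H : exists M, 0 <= M /\ forall h u, norm (B (expand l h) u) <= M * norm h * norm u).
  { clear Hl; induction l as [ | e l (M & HM & HlM)]; simpl.
    - exists 0; split; [ lra | ]; intros h u.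
      rewrite (linear_zero (fun h => B h u)), norm_zero; auto; lra.
    - destruct (linear_bounded (B e) (HB1 e)) as (Me & HMe & He).
      exists (norm e * Me + M); pose proof (norm_pos e).
      split; [ nra | ]; intros h u.
      rewrite (linear_add (fun h => B h u)), (linear_scal (fun h => B h u)) by auto.
      eapply Rle_trans; [ apply norm_triangle | ]; rewrite norm_scal.
      specialize (HlM h u); specialize (He u); pose proof (cauchy_schwarz_abs h e).
      pose proof (norm_pos (B e u)); pose proof (norm_pos u); pose proof (norm_pos h).
      assert (Rabs (ip h e) * norm (B e u) <= (norm h * norm e) * (Me * norm u)).
      { apply Rmult_le_compat; auto; apply Rabs_pos. }
      nra. }
  destruct H as (M & HM & H); exists M; split; auto; intros h u; specialize (H h u).
  rewrite <- Hl in H; exact H.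
Qed.

Lemma deriv_continuous {E F : ipspace} {HE : fd_ips E} {HF : fd_ips F}
  (f : E -> F) (x : E) (L : E -> F) :
  has_deriv_at f x L ->
  forall eps, 0 < eps -> exists del, 0 < del /\
    forall z, norm (vsub z x) < del -> norm (vsub (f z) (f x)) < eps.
Proof.
  intros [HL Hf] eps Heps.
  destruct (linear_bounded L HL) as (M & HM & HLM).
  destruct (Hf 1 Rlt_0_1) as (del & Hdel & H).
  assert (HM1 : 0 < eps / (M + 1)) by (apply Rdiv_lt_0_compat; lra).
  exists (Rmin del (eps / (M + 1))); split; [ apply Rmin_glb_lt; auto | ].
  intros z Hz.
  pose proof (Rmin_l del (eps / (M + 1))); pose proof (Rmin_r del (eps / (M + 1))).
  specialize (H (vsub z x) ltac:(lra)); specialize (HLM (vsub z x)).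
  replace (vadd x (vsub z x)) with z in H by veq.
  pose proof (norm_le_sub (vsub (f z) (f x)) (L (vsub z x))).
  assert (norm (vsub z x) * (M + 1) < eps); [ | nra ].
  replace eps with (eps / (M + 1) * (M + 1)) by (field; lra).
  apply Rmult_lt_compat_r; lra.
Qed.

Lemma deriv_seq_cv {E F : ipspace} {HE : fd_ips E} {HF : fd_ips F}
  (f : E -> F) (x : E) (L : E -> F) (u : nat -> E) :
  has_deriv_at f x L -> seq_cv u x -> seq_cv (fun k => f (u k)) (f x).
Proof.
  intros Hf Hu eps Heps.
  destruct (deriv_continuous f x L Hf eps Heps) as (del & Hdel & H).
  destruct (Hu del Hdel) as [N HN]; exists N; auto.
Qed.

Lemma difference_quotient_cv {E F : ipspace} {HE : fd_ips E} {HF : fd_ips F}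
  (f : E -> F) (x : E) (L : E -> F) (v : E) (t : nat -> R) :
  has_deriv_at f x L -> down0 t ->
  seq_cv (fun k => vscal (/ t k) (vsub (f (vadd x (vscal (t k) v))) (f x))) (L v).
Proof.
  intros [HL Hf] [Ht Ht0] eps Heps.
  pose proof (norm_pos v) as Hv.
  (* The [+ 1] covers [v = 0]. *)
  destruct (Hf (eps / (norm v + 1))) as (del & Hdel & H); [ apply Rdiv_lt_0_compat; lra | ].
  destruct (Ht0 (del / (norm v + 1))) as [N HN]; [ apply Rdiv_lt_0_compat; lra | ].
  exists N; intros k Hk; specialize (HN k Hk); specialize (Ht k).
  rewrite Rminus_0_r, Rabs_pos_eq in HN by lra.
  assert (Hd : t k * norm v < del).
  { replace del with (del / (norm v + 1) * (norm v + 1)) by (field; lra).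
    apply Rle_lt_trans with (t k * (norm v + 1)); [ nra | apply Rmult_lt_compat_r; lra ]. }
  specialize (H (vscal (t k) v)); rewrite norm_scal_pos in H by lra; specialize (H Hd).
  rewrite (linear_scal L) in H by auto.
  set (r := vsub (vsub (f (vadd x (vscal (t k) v))) (f x)) (vscal (t k) (L v))) in *.
  replace (vsub (vscal (/ t k) (vsub (f (vadd x (vscal (t k) v))) (f x))) (L v))
    with (vscal (/ t k) r) by (unfold r; apply ip_ext; intro e; ipl; field; lra).
  pose proof (Rinv_0_lt_compat _ Ht) as Hti; rewrite norm_scal_pos by lra.
  apply Rle_lt_trans with (/ t k * (eps / (norm v + 1) * (t k * norm v))).
  - apply Rmult_le_compat_l; lra.
  - replace (/ t k * (eps / (norm v + 1) * (t k * norm v)))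
      with (eps * (norm v / (norm v + 1))) by (field; lra).
    assert (norm v / (norm v + 1) < 1); [ | nra ].
    apply Rmult_lt_reg_r with (norm v + 1); [ lra | ].
    replace (norm v / (norm v + 1) * (norm v + 1)) with (norm v) by (field; lra); lra.
Qed.

Lemma line_derivable {E F : ipspace} {HE : fd_ips E} {HF : fd_ips F}
  (f : E -> F) (x h : E) (e : F) (s : R) (L : E -> F) :
  has_deriv_at f (vadd x (vscal s h)) L ->
  derivable_pt_lim (fun s => ip e (f (vadd x (vscal s h)))) s (ip e (L h)).
Proof.
  intros [HL Hf] eps Heps.
  pose proof (norm_pos h) as Hh; pose proof (norm_pos e) as He.
  assert (Hc : 0 < norm e * norm h + 1) by nra.
  destruct (Hf (eps / (norm e * norm h + 1))) as (del & Hdel & H).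
  { apply Rdiv_lt_0_compat; lra. }
  assert (Hd : 0 < del / (norm h + 1)) by (apply Rdiv_lt_0_compat; lra).
  exists (mkposreal _ Hd); simpl; intros t Ht Htd.
  pose proof (Rabs_pos_lt t Ht) as Hat.
  assert (Hth : norm (vscal t h) < del).
  { rewrite norm_scal; replace del with (del / (norm h + 1) * (norm h + 1)) by (field; lra).
    apply Rle_lt_trans with (Rabs t * (norm h + 1)); [ nra | apply Rmult_lt_compat_r; lra ]. }
  specialize (H _ Hth); rewrite (linear_scal L), norm_scal in H by auto.
  replace (vadd (vadd x (vscal s h)) (vscal t h)) with (vadd x (vscal (s + t) h)) in H by veq.
  set (r := vsub (vsub (f (vadd x (vscal (s + t) h))) (f (vadd x (vscal s h)))) (vscal t (L h))) in *.
  replace ((ip e (f (vadd x (vscal (s + t) h))) - ip e (f (vadd x (vscal s h)))) / t - ip e (L h))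
    with (ip e r / t).
  2:{ unfold r; unfold vsub; rewrite !ip_addr, !ip_oppr, !ip_scalr; field; auto. }
  unfold Rdiv; rewrite Rabs_mult, Rabs_inv.
  apply Rmult_lt_reg_r with (Rabs t); auto.
  rewrite Rmult_assoc, Rinv_l, Rmult_1_r by lra.
  eapply Rle_lt_trans; [ apply cauchy_schwarz_abs | ].
  apply Rle_lt_trans with (norm e * (eps / (norm e * norm h + 1) * (Rabs t * norm h))).
  - apply Rmult_le_compat_l; auto.
  - replace (norm e * (eps / (norm e * norm h + 1) * (Rabs t * norm h)))
      with (eps * Rabs t * ((norm e * norm h) / (norm e * norm h + 1))) by (field; lra).
    assert (norm e * norm h / (norm e * norm h + 1) < 1).
    { apply Rmult_lt_reg_r with (norm e * norm h + 1); auto.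
      replace (norm e * norm h / (norm e * norm h + 1) * (norm e * norm h + 1))
        with (norm e * norm h) by (field; lra); lra. }
    assert (0 < eps * Rabs t) by nra; nra.
Qed.

(** The mean value theorem after subtracting [p s + q s^2 / 2]. The choice [p = q = 0] serves
    Lipschitz bounds; first and second derivatives paired with [e] serve Taylor expansions. *)
Lemma line_mean_value {E F : ipspace} {HE : fd_ips E} {HF : fd_ips F}
  (f : E -> F) (Df : E -> E -> F) (x h : E) (e : F) (p q : R) :
  (forall z, has_deriv_at f z (Df z)) ->
  exists c, 0 < c < 1 /\
    ip e (f (vadd x h)) - ip e (f x) - p - q / 2 = ip e (Df (vadd x (vscal c h)) h) - p - c * q.
Proof.
  intro Hf.
  destruct (MVT_cor2
    (fun s => ip e (f (vadd x (vscal s h))) - (p * s + q / 2 * (s * s)))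
    (fun s => ip e (Df (vadd x (vscal s h)) h) - (p * 1 + q / 2 * (1 * s + s * 1))) 0 1)
    as (c & Hc & Hc01).
  - lra.
  - intros s _.
    apply (derivable_pt_lim_minus _ (fun s => p * s + q / 2 * (s * s))).
    + apply line_derivable, Hf.
    + apply (derivable_pt_lim_plus (fun s => p * s) (fun s => q / 2 * (s * s))).
      * apply (derivable_pt_lim_scal id), derivable_pt_lim_id.
      * apply (derivable_pt_lim_scal (fun s => s * s)).
        apply (derivable_pt_lim_mult id id); apply derivable_pt_lim_id.
  - exists c; split; auto.
    replace (vadd x (vscal 1 h)) with (vadd x h) in Hc by veq.
    replace (vadd x (vscal 0 h)) with x in Hc by veq.
    lra.
Qed.

Lemma deriv_locally_bounded {E F : ipspace} {HE : fd_ips E} {HF : fd_ips F}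
  (f : E -> F) (Df : E -> E -> F) (D2f : E -> E -> E -> F) (x : E) :
  twice_diff f Df D2f ->
  exists l rho, 0 < l /\ 0 < rho /\
    forall z u, norm (vsub z x) < rho -> norm (vsub (Df z u) (Df x u)) <= l * norm (vsub z x) * norm u.
Proof.
  intro H; destruct (H x) as (_ & HB1 & HB2 & H2).
  destruct (bilinear_bounded _ HB1 HB2) as (M & HM & HMB).
  destruct (H2 1 Rlt_0_1) as (del & Hdel & Hd).
  exists (M + 1), del; repeat split; auto; [ lra | ].
  intros z u Hz; specialize (Hd _ Hz u); specialize (HMB (vsub z x) u).
  replace (vadd x (vsub z x)) with z in Hd by veq.
  pose proof (norm_le_sub (vsub (Df z u) (Df x u)) (D2f x (vsub z x) u)).
  pose proof (norm_pos u); pose proof (norm_pos (vsub z x)); nra.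
Qed.

Lemma deriv_direction_cv {E F : ipspace} {HE : fd_ips E} {HF : fd_ips F}
  (f : E -> F) (Df : E -> E -> F) (D2f : E -> E -> E -> F) (x v : E) (u : nat -> E) :
  twice_diff f Df D2f -> seq_cv u x -> seq_cv (fun k => Df (u k) v) (Df x v).
Proof.
  intros H Hu; destruct (deriv_locally_bounded f Df D2f x H) as (l & rho & Hl & Hrho & Hb).
  apply seq_cv_bound with (fun k => l * norm (vsub (u k) x) * norm v).
  - destruct (Hu rho Hrho) as [N HN]; exists N; auto.
  - apply seq_cv_norm in Hu; replace 0 with (l * 0 * norm v) by ring.
    apply R_cv_mult; auto using R_cv_const; apply R_cv_scal; auto.
Qed.

Lemma locally_lipschitz {E F : ipspace} {HE : fd_ips E} {HF : fd_ips F}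
  (f : E -> F) (Df : E -> E -> F) (D2f : E -> E -> E -> F) (x : E) :
  twice_diff f Df D2f ->
  exists l rho, 0 < l /\ 0 < rho /\
    forall a b, norm (vsub a x) < rho -> norm (vsub b x) < rho ->
      norm (vsub (f b) (f a)) <= l * norm (vsub b a).
Proof.
  intro H; destruct (deriv_locally_bounded f Df D2f x H) as (l & rho & Hl & Hrho & Hb).
  destruct (linear_bounded (Df x)) as (M & HM & HMD); [ apply H | ].
  exists (l * rho + M + 1), rho; repeat split; auto; [ nra | ].
  intros a b Ha Hb'.
  set (e := vsub (f b) (f a)); set (h := vsub b a).
  destruct (line_mean_value f Df a h e 0 0) as (c & Hc & Heq); [ intro; apply H | ].
  replace (vadd a h) with b in Heq by (unfold h; veq).
  set (z := vadd a (vscal c h)) in *.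
  assert (Hz : norm (vsub z x) < rho).
  { replace (vsub z x) with (vadd (vscal (1 - c) (vsub a x)) (vscal c (vsub b x)))
      by (unfold z, h; veq).
    eapply Rle_lt_trans; [ apply norm_triangle | ].
    rewrite !norm_scal_pos by lra.
    assert ((1 - c) * norm (vsub a x) < (1 - c) * rho) by (apply Rmult_lt_compat_l; lra).
    assert (c * norm (vsub b x) < c * rho) by (apply Rmult_lt_compat_l; lra).
    lra. }
  specialize (Hb z h Hz); specialize (HMD h).
  pose proof (norm_le_sub (Df z h) (Df x h)).
  assert (He : norm e * norm e = ip e (Df z h)).
  { rewrite norm_sq; unfold e at 2; unfold vsub; rewrite ip_addr, ip_oppr; lra. }
  pose proof (norm_pos h).
  assert (HD : norm (Df z h) <= (l * rho + M + 1) * norm h).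
  { assert (l * norm (vsub z x) * norm h <= l * rho * norm h).
    { apply Rmult_le_compat_r; auto; apply Rmult_le_compat_l; lra. }
    nra. }
  apply norm_le_of_self_ip with (Df z h); auto; lra.
Qed.

(** Once the quadratic model is subtracted, the mean value remainder is
    [Df (x + c h) h - Df x h - D2f x (c h) h], which differentiability of [Df] at [x] bounds by
    [eps |h|^2]. *)
Lemma taylor2 {E F : ipspace} {HE : fd_ips E} {HF : fd_ips F}
  (f : E -> F) (Df : E -> E -> F) (D2f : E -> E -> E -> F) (x : E) (eps : R) :
  twice_diff f Df D2f -> 0 < eps ->
  exists del, 0 < del /\ forall h, norm h < del ->
    norm (vsub (f (vadd x h)) (vadd (f x) (vadd (Df x h) (vscal (/ 2) (D2f x h h)))))
      <= eps * (norm h * norm h).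
Proof.
  intros H Heps; destruct (H x) as (_ & HB1 & HB2 & H2).
  destruct (H2 eps Heps) as (del & Hdel & Hd).
  exists del; split; auto; intros h Hh.
  set (e := vsub (f (vadd x h)) _).
  destruct (line_mean_value f Df x h e (ip e (Df x h)) (ip e (D2f x h h)))
    as (c & Hc & Heq); [ intro; apply H | ].
  set (r := vsub (vsub (Df (vadd x (vscal c h)) h) (Df x h)) (D2f x (vscal c h) h)).
  assert (He : norm e * norm e = ip e r).
  { rewrite norm_sq; unfold e at 2; unfold r.
    rewrite (linear_scal (fun h' => D2f x h' h)) by auto.
    unfold vsub; rewrite ?ip_addr, ?ip_oppr, ?ip_addr, ?ip_scalr; lra. }
  assert (Hr : norm r <= eps * (norm h * norm h)).
  { pose proof (norm_pos h).
    eapply Rle_trans; [ apply Hd; rewrite norm_scal_pos by lra; nra | ].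
    rewrite norm_scal_pos by lra.
    replace (eps * (norm h * norm h)) with (eps * norm h * norm h) by ring.
    apply Rmult_le_compat_r; auto; apply Rmult_le_compat_l; nra. }
  apply norm_le_of_self_ip with r; auto.
Qed.

Lemma taylor2_so_path {E F : ipspace} {HE : fd_ips E} {HF : fd_ips F}
  (f : E -> F) (Df : E -> E -> F) (D2f : E -> E -> E -> F) (x d v : E) (eps : R) :
  twice_diff f Df D2f -> 0 < eps ->
  exists del, 0 < del /\ forall t, 0 < t < del ->
    norm (vsub (f (so_path x d v t))
               (so_path (f x) (Df x d) (vadd (Df x v) (D2f x d d)) t)) <= eps * (t * t).
Proof.
  intros H Heps.
  set (m := norm d + norm v).
  assert (Hm : 0 <= m) by (unfold m; pose proof (norm_pos d); pose proof (norm_pos v); lra).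
  destruct (taylor2 f Df D2f x (eps / (2 * (m * m + 1))) H) as (del & Hdel & Hd).
  { apply Rdiv_lt_0_compat; nra. }
  destruct (H x) as ((HL & _) & HB1 & HB2 & _).
  set (b := norm (D2f x d v) + norm (D2f x v d) + norm (D2f x v v)).
  assert (Hb : 0 <= b).
  { unfold b; pose proof (norm_pos (D2f x d v)); pose proof (norm_pos (D2f x v d)).
    pose proof (norm_pos (D2f x v v)); lra. }
  (* [d1] keeps [|h| <= t m] below [del], and [d2] holds the cross terms to [eps t^2 / 2]; the
     constant passed to [taylor2] leaves the other half. Taking [t < 1] absorbs higher powers. *)
  set (d1 := del / (m + 1)); set (d2 := eps / (2 * (b + 1))).
  assert (Hd1 : 0 < d1) by (apply Rdiv_lt_0_compat; lra).
  assert (Hd2 : 0 < d2) by (apply Rdiv_lt_0_compat; lra).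
  assert (Hd1' : d1 * (m + 1) = del) by (unfold d1; field; lra).
  assert (Hd2' : d2 * (2 * (b + 1)) = eps) by (unfold d2; field; lra).
  exists (Rmin 1 (Rmin d1 d2)); split; [ repeat apply Rmin_glb_lt; auto; lra | ].
  intros t [Ht Htd].
  pose proof (Rmin_l 1 (Rmin d1 d2)); pose proof (Rmin_r 1 (Rmin d1 d2)).
  pose proof (Rmin_l d1 d2); pose proof (Rmin_r d1 d2).
  set (h := vadd (vscal t d) (vscal (/ 2 * (t * t)) v)).
  assert (Hh : norm h <= t * m).
  { eapply Rle_trans; [ apply norm_triangle | ]; rewrite !norm_scal_pos by nra.
    unfold m; pose proof (norm_pos v).
    assert (/ 2 * (t * t) * norm v <= t * norm v) by (apply Rmult_le_compat_r; nra).
    lra. }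
  assert (Hhd : norm h < del).
  { apply Rle_lt_trans with (t * m); auto; rewrite <- Hd1'.
    apply Rle_lt_trans with (t * (m + 1)); [ nra | apply Rmult_lt_compat_r; lra ]. }
  specialize (Hd h Hhd); pose proof (norm_pos h) as Hh0.
  change (so_path x d v t) with (vadd x h).
  set (r := vsub (f (vadd x h)) _) in Hd.
  (* The terms of [D2f x h h / 2] beyond [D2f x d d], divided by [t^2]. Both mixed terms appear
     because [D2f x] is not assumed symmetric. *)
  set (w := vadd (vscal (/ 4 * t) (vadd (D2f x d v) (D2f x v d))) (vscal (/ 8 * (t * t)) (D2f x v v))).
  replace (vsub (f (vadd x h)) _) with (vadd r (vscal (t * t) w)).
  2:{ unfold r, w, so_path.
      replace (D2f x h h) with
        (vadd (vscal t (D2f x d h)) (vscal (/ 2 * (t * t)) (D2f x v h)))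
        by (unfold h at 3; symmetry; apply (HB2 h)).
      unfold h at 2 3 4.
      rewrite (HL t), (HB1 d t), (HB1 v t).
      apply ip_ext; intro e; ipl; field. }
  assert (Hw : norm w <= t * b).
  { eapply Rle_trans; [ apply norm_triangle | ]; rewrite !norm_scal_pos by nra.
    pose proof (norm_triangle (D2f x d v) (D2f x v d)); unfold b.
    pose proof (norm_pos (D2f x d v)); pose proof (norm_pos (D2f x v d)).
    pose proof (norm_pos (D2f x v v)).
    assert (/ 8 * (t * t) * norm (D2f x v v) <= t * norm (D2f x v v)).
    { apply Rmult_le_compat_r; nra. }
    nra. }
  eapply Rle_trans; [ apply norm_triangle | ]; rewrite norm_scal_pos by nra.
  assert (norm r <= eps / 2 * (t * t)).
  { eapply Rle_trans; [ apply Hd | ].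
    replace (eps / 2 * (t * t)) with (eps / (2 * (m * m + 1)) * ((m * m + 1) * (t * t)))
      by (field; nra).
    apply Rmult_le_compat_l; [ apply Rlt_le, Rdiv_lt_0_compat; nra | nra ]. }
  assert (norm w <= eps / 2) by nra.
  assert (t * t * norm w <= t * t * (eps / 2)) by (apply Rmult_le_compat_l; nra).
  lra.
Qed.

(** * Optimality conditions *)

(** Subregularity puts a feasible [x'] within about [kap |U x - z|] of [x], and passing from
    [phi x'] to [phi x] costs the Lipschitz constant [l]; hence the penalty constant [l * kap]. *)
Lemma exact_penalty {X Z : ipspace} {HX : fd_ips X} {HZ : fd_ips Z}
  (phi : X -> R) (Dphi : X -> X -> R) (D2phi : X -> X -> X -> R)
  (U : X -> Z) (DU : X -> X -> Z) (D2U : X -> X -> X -> Z) (C : Z -> Prop) (xs : X) :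
  @twice_diff X R_ips phi Dphi D2phi -> twice_diff U DU D2U ->
  local_min phi (feasible U C) xs -> metric_subregular U C xs ->
  exists L rho, 0 < L /\ 0 < rho /\
    forall x z, norm (vsub x xs) <= rho -> C z -> norm (vsub z (U xs)) <= rho ->
      phi xs <= phi x + L * norm (vsub (U x) z).
Proof.
  intros Hphi HU [HS (r2 & Hr2 & Hmin)] (kap & r3 & Hkap & Hr3 & Hsub).
  destruct (@locally_lipschitz X R_ips _ _ phi Dphi D2phi xs Hphi) as (l & r1 & Hl & Hr1 & Hlip).
  set (d0 := Rmin r1 (Rmin r2 r3)).
  assert (Hd0 : 0 < d0) by (repeat apply Rmin_glb_lt; auto).
  assert (H1 : d0 <= r1) by apply Rmin_l.
  assert (H2 : d0 <= r2) by (eapply Rle_trans; [ apply Rmin_r | apply Rmin_l ]).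
  assert (H3 : d0 <= r3) by (eapply Rle_trans; [ apply Rmin_r | apply Rmin_r ]).
  (* Then [|U x - z| <= 2 eta0], so [kap r <= d0 / 4]; with [|x - xs|] and the slack [eta] each at
     most [d0 / 4], the point [x'] stays within [d0] of [xs]. *)
  set (eta0 := d0 / (8 * kap)).
  assert (He0 : 0 < eta0) by (apply Rdiv_lt_0_compat; lra).
  assert (He0' : kap * eta0 = d0 / 8) by (unfold eta0; field; lra).
  destruct (deriv_continuous U xs (DU xs) (proj1 (HU xs)) eta0 He0) as (del & Hdel & Hcont).
  exists (l * kap), (Rmin (d0 / 4) (Rmin (del / 2) eta0)); repeat split.
  { nra. }
  { repeat apply Rmin_glb_lt; lra. }
  set (rho := Rmin (d0 / 4) (Rmin (del / 2) eta0)).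
  assert (Hrho1 : rho <= d0 / 4) by apply Rmin_l.
  assert (Hrho2 : rho <= del / 2) by (eapply Rle_trans; [ apply Rmin_r | apply Rmin_l ]).
  assert (Hrho3 : rho <= eta0) by (eapply Rle_trans; [ apply Rmin_r | apply Rmin_r ]).
  intros x z Hx Hz Hzr.
  set (r := norm (vsub (U x) z)).
  assert (Hr : kap * r <= d0 / 4).
  { specialize (Hcont x ltac:(lra)).
    pose proof (norm_sub_triangle (U xs) (U x) z) as Ht; fold r in Ht.
    rewrite (norm_sub_sym (U xs) z) in Ht; nra. }
  apply le_of_le_add_small with l (d0 / 4); [ lra | ].
  intros eta Heta.
  destruct (Hsub x ltac:(lra) r) with (eta := eta) as (x' & Hx' & Hn); [ | lra | ].
  { intros eta' Heta'; exists z; split; auto; fold r; lra. }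
  assert (Hx'd : norm (vsub x' xs) < d0).
  { pose proof (norm_sub_triangle x x' xs); rewrite (norm_sub_sym x' x) in *; lra. }
  specialize (Hmin x' Hx' ltac:(lra)).
  specialize (Hlip x x' ltac:(lra) ltac:(lra)); rewrite norm_R in Hlip; simpl in Hlip.
  rewrite (norm_sub_sym x' x) in Hlip.
  pose proof (Rle_abs (phi x' + - phi x)).
  assert (l * norm (vsub x x') <= l * (kap * r + eta)) by (apply Rmult_le_compat_l; lra).
  lra.
Qed.

(** Normality and stationarity require the two ball constraints to be inactive, hence the
    implication; the unconditional estimates make its premises true for large [k]. *)
Lemma penalty_multiplier {X Z : ipspace} {HX : fd_ips X} {HZ : fd_ips Z}
  (phi : X -> R) (Dphi : X -> X -> R) (D2phi : X -> X -> X -> R)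
  (U : X -> Z) (DU : X -> X -> Z) (D2U : X -> X -> X -> Z) (C : Z -> Prop) (xs : X) (L rho k : R) :
  @twice_diff X R_ips phi Dphi D2phi -> twice_diff U DU D2U -> closed C -> C (U xs) ->
  0 < L -> 0 < rho -> 0 < k ->
  (forall x z, norm (vsub x xs) <= rho -> C z -> norm (vsub z (U xs)) <= rho ->
      phi xs <= phi x + L * norm (vsub (U x) z)) ->
  exists x z, C z /\
    norm (vsub x xs) * norm (vsub x xs) <= L * L * / k /\ norm (vsub (U x) z) <= L * / k /\
    (norm (vsub x xs) < rho -> norm (vsub z (U xs)) < rho ->
     regular_normal C z (vscal (2 * k) (vsub (U x) z)) /\
     forall v, 0 <= Dphi x v + 2 * ip (vsub x xs) v + ip (vscal (2 * k) (vsub (U x) z)) (DU x v)).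
Proof.
  intros Hphi HU HC Hy HL Hrho Hk Hpen.
  destruct (penalty_minimum (fun x => norm (vsub x xs) <= rho) xs (norm xs + rho)
    (fun x => phi x + ip (vsub x xs) (vsub x xs)) U C (U xs) rho k)
    as (x & z & Hx & Hz & Hzr & Hmin); auto.
  - rewrite vsub_diag, norm_zero; lra.
  - intros u a Hu Ha; apply norm_cv_le with u; auto.
  - intros p Hp; pose proof (norm_le_sub p xs); lra.
  - lra.
  - intros u a Ha; apply R_cv_plus.
    + apply seq_cv_R, (@deriv_seq_cv X R_ips _ _ phi a (Dphi a)); auto; apply Hphi.
    + apply R_cv_ip; apply seq_cv_sub_vec; auto using seq_cv_const.
  - intros u a Ha; apply (deriv_seq_cv U a (DU a)); auto; apply HU.
  - set (r := norm (vsub (U x) z)); pose proof (norm_pos (vsub (U x) z)) as Hr; fold r in Hr.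
    (* Minimality against the pair [(xs, U xs)], whose residual vanishes, followed by the exact
       penalty inequality at [(x, z)]. *)
    assert (Hkr : norm (vsub x xs) * norm (vsub x xs) + k * (r * r) <= L * r).
    { pose proof (Hpen x z Hx Hz Hzr) as H1; fold r in H1.
      specialize (Hmin xs (U xs)); rewrite !vsub_diag, !norm_zero, !ip_zerol in Hmin.
      specialize (Hmin ltac:(lra) Hy ltac:(lra)).
      rewrite <- !norm_sq in Hmin; fold r in Hmin; lra. }
    assert (Hr' : r <= L * / k).
    { apply Rmult_le_reg_l with k; auto.
      replace (k * (L * / k)) with L by (field; lra).
      destruct (Req_dec r 0) as [-> | H0]; [ lra | ].
      apply Rmult_le_reg_r with r; [ lra | ].
      pose proof (Rle_0_sqr (norm (vsub x xs))) as Hs; unfold Rsqr in Hs; lra. }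
    exists x, z; repeat split; auto.
    { replace (L * L * / k) with (L * (L * / k)) by ring; nra. }
    { apply proximal_normal with (rho - norm (vsub z (U xs))); try lra.
      intros c' Hc' Hn; apply Rmult_le_reg_l with k; auto.
      apply Rplus_le_reg_l with (phi x + ip (vsub x xs) (vsub x xs)); apply Hmin; auto.
      pose proof (norm_sub_triangle z c' (U xs)); lra. }
    intros v.
    set (t := fun i : nat => / (INR i + 1)).
    assert (Ht : down0 t) by (split; [ exact inv_S_pos | exact R_cv_inv_S ]).
    pose proof (@difference_quotient_cv X R_ips _ _ phi x (Dphi x) v t (proj1 (Hphi x)) Ht) as Hq1.
    pose proof (difference_quotient_cv U x (DU x) v t (proj1 (HU x)) Ht) as Hq2.
    apply seq_cv_R in Hq1.
    set (w := fun i => vscal (/ t i) (vsub (U (vadd x (vscal (t i) v))) (U x))) in Hq2.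
    destruct Ht as [Ht Ht0].
    rewrite ip_scall.
    (* The zero terms are the limits of the quadratic terms [t_i |v|^2] and [t_i |w_i|^2] of the
       difference quotient. *)
    replace (Dphi x v + 2 * ip (vsub x xs) v + 2 * k * ip (vsub (U x) z) (DU x v))
      with (Dphi x v + (2 * ip (vsub x xs) v + 0 * ip v v) +
            k * (2 * ip (vsub (U x) z) (DU x v) + 0 * ip (DU x v) (DU x v))) by ring.
    apply R_cv_eventually_le with (fun _ => 0)
      (fun i => / t i * (phi (vadd x (vscal (t i) v)) + - phi x)
                + (2 * ip (vsub x xs) v + t i * ip v v)
                + k * (2 * ip (vsub (U x) z) (w i) + t i * ip (w i) (w i))).
    + assert (Hcv : seq_cv (fun i => vadd x (vscal (t i) v)) x).
      { replace (seq_cv _ x) with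
          (seq_cv (fun i => vadd x (vscal (t i) v)) (vadd x (vscal 0 v))) by (f_equal; veq).
        apply seq_cv_add; auto using seq_cv_const; apply seq_cv_scal; auto using seq_cv_const. }
      destruct (Hcv (rho - norm (vsub x xs))) as [N HN]; [ lra | ].
      exists N; intros i Hi; specialize (HN i Hi); specialize (Ht i).
      set (x' := vadd x (vscal (t i) v)) in *.
      assert (Hx' : norm (vsub x' xs) <= rho)
        by (pose proof (norm_sub_triangle x x' xs); lra).
      specialize (Hmin x' z Hx' Hz Hzr).
      replace (vsub x' xs) with (vadd (vsub x xs) (vscal (t i) v)) in Hmin by (unfold x'; veq).
      replace (vsub (U x') z) with (vadd (vsub (U x) z) (vscal (t i) (w i))) in Hmin.
      2:{ unfold w; fold x'; rewrite vscal_vscal, Rinv_r by lra; veq. }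
      set (a := vsub x xs) in *; set (b := vsub (U x) z) in *.
      rewrite (ip_addl a (vscal (t i) v)), (ip_addl b (vscal (t i) (w i))),
        !ip_addr, !ip_scall, !ip_scalr, (ip_sym v a), (ip_sym (w i) b) in Hmin.
      assert (Hdiv : forall p q r, 0 <= p + t i * q + t i * r -> 0 <= / t i * p + q + r).
      { intros p q r' Hp; apply Rmult_le_reg_l with (t i); auto.
        replace (t i * (/ t i * p + q + r')) with (p + t i * q + t i * r') by (field; lra); lra. }
      apply Hdiv; lra.
    + apply R_cv_const.
    + apply R_cv_plus; [ apply R_cv_plus; [ exact Hq1 | ] | apply R_cv_scal ].
      * apply R_cv_plus; [ apply R_cv_const | apply R_cv_mult; auto using R_cv_const ].
      * apply R_cv_plus; [ apply R_cv_scal | apply R_cv_mult; auto ];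
          apply R_cv_ip; auto using seq_cv_const.
Qed.

Lemma limiting_multiplier_exists {X Z : ipspace} {HX : fd_ips X} {HZ : fd_ips Z}
  (phi : X -> R) (Dphi : X -> X -> R) (D2phi : X -> X -> X -> R)
  (U : X -> Z) (DU : X -> X -> Z) (D2U : X -> X -> X -> Z) (C : Z -> Prop) (xs : X) :
  @twice_diff X R_ips phi Dphi D2phi -> twice_diff U DU D2U -> closed C ->
  local_min phi (feasible U C) xs -> metric_subregular U C xs ->
  exists m, mult_set limiting_normal Dphi U DU C xs m.
Proof.
  intros Hphi HU HC Hmin Hsub.
  destruct (exact_penalty phi Dphi D2phi U DU D2U C xs) as (L & rho & HL & Hrho & Hpen); auto.
  assert (H : forall i : nat, exists q : X * Z, C (snd q) /\
    norm (vsub (fst q) xs) * norm (vsub (fst q) xs) <= L * L * / (INR i + 1) /\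
    norm (vsub (U (fst q)) (snd q)) <= L * / (INR i + 1) /\
    (norm (vsub (fst q) xs) < rho -> norm (vsub (snd q) (U xs)) < rho ->
     regular_normal C (snd q) (vscal (2 * (INR i + 1)) (vsub (U (fst q)) (snd q))) /\
     forall v, 0 <= Dphi (fst q) v + 2 * ip (vsub (fst q) xs) v
                 + ip (vscal (2 * (INR i + 1)) (vsub (U (fst q)) (snd q))) (DU (fst q) v))).
  { intro i; pose proof (pos_INR i).
    destruct (penalty_multiplier phi Dphi D2phi U DU D2U C xs L rho (INR i + 1))
      as (x & z & Hxz); auto; [ apply Hmin | lra | ].
    exists (x, z); exact Hxz. }
  apply functional_choice in H; destruct H as [q Hq].
  assert (Hx : seq_cv (fun i => fst (q i)) xs).
  { intros eps Heps.
    destruct (R_cv_scal (L * L) _ _ R_cv_inv_S (eps * eps)) as [N HN]; [ nra | ].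
    exists N; intros i Hi; specialize (HN i Hi); destruct (Hq i) as (_ & H & _).
    pose proof (Rle_abs (L * L * / (INR i + 1) - L * L * 0)).
    pose proof (norm_pos (vsub (fst (q i)) xs)); nra. }
  assert (HUx : seq_cv (fun i => U (fst (q i))) (U xs)).
  { apply (deriv_seq_cv U xs (DU xs)); auto; apply HU. }
  assert (Hz : seq_cv (fun i => snd (q i)) (U xs)).
  { apply seq_cv_bound with (fun i => L * / (INR i + 1) + norm (vsub (U (fst (q i))) (U xs))).
    - exists 0%nat; intros i _; destruct (Hq i) as (_ & _ & H & _).
      rewrite norm_sub_sym in H.
      pose proof (norm_sub_triangle (U (fst (q i))) (snd (q i)) (U xs)); lra.
    - replace 0 with (L * 0 + 0) by ring; apply R_cv_plus.
      + apply R_cv_scal, R_cv_inv_S.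
      + apply seq_cv_norm; auto. }
  set (lam := fun i => vscal (2 * (INR i + 1)) (vsub (U (fst (q i))) (snd (q i)))).
  destruct (Hx rho Hrho) as [N1 HN1]; destruct (Hz rho Hrho) as [N2 HN2].
  (* From this index on both ball constraints are inactive. *)
  set (N := (N1 + N2)%nat).
  assert (Hcrit : forall i, regular_normal C (snd (q (N + i)%nat)) (lam (N + i)%nat) /\
     forall v, 0 <= Dphi (fst (q (N + i)%nat)) v + 2 * ip (vsub (fst (q (N + i)%nat)) xs) v
                 + ip (lam (N + i)%nat) (DU (fst (q (N + i)%nat)) v)).
  { intro i; apply (Hq (N + i)%nat); [ apply HN1 | apply HN2 ]; unfold N; lia. }
  destruct (bolzano_weierstrass (fun i => lam (N + i)%nat) (2 * L)) as (s & m & Hs & Hm).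
  { intro i; destruct (Hq (N + i)%nat) as (_ & _ & H & _); unfold lam.
    pose proof (pos_INR (N + i)); rewrite norm_scal_pos by lra.
    apply Rle_trans with (2 * (INR (N + i) + 1) * (L * / (INR (N + i) + 1))).
    - apply Rmult_le_compat_l; lra.
    - right; field; lra. }
  assert (Hsub' : forall i, (i <= N + s i)%nat) by (intro i; specialize (Hs i); lia).
  pose proof (seq_cv_sub _ _ _ Hsub' Hx) as Hxs; simpl in Hxs.
  pose proof (seq_cv_sub _ _ _ Hsub' Hz) as Hzs; simpl in Hzs.
  (* The proximal contribution [2 <x_i - xs, v>] disappears in the limit; applying the inequality to
     [v] and [- v] then yields the gradient equation. *)
  assert (Hge : forall v, 0 <= Dphi xs v + ip m (DU xs v)).
  { intro v; replace (Dphi xs v + ip m (DU xs v))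
      with (Dphi xs v + 2 * ip (vsub xs xs) v + ip m (DU xs v)) by (rewrite vsub_diag, ip_zerol; ring).
    apply R_cv_le with (fun _ => 0)
      (fun i => Dphi (fst (q (N + s i)%nat)) v + 2 * ip (vsub (fst (q (N + s i)%nat)) xs) v
                + ip (lam (N + s i)%nat) (DU (fst (q (N + s i)%nat)) v)).
    - intro i; apply Hcrit.
    - apply R_cv_const.
    - apply R_cv_plus; [ apply R_cv_plus | ].
      + apply seq_cv_R, (@deriv_direction_cv X R_ips _ _ phi Dphi D2phi); auto.
      + apply R_cv_scal, R_cv_ip; auto using seq_cv_const.
        apply seq_cv_sub_vec; auto using seq_cv_const.
      + apply R_cv_ip; auto; apply (deriv_direction_cv U DU D2U); auto. }
  exists m; split.
  - intro v; apply Rle_antisym; [ | apply Hge ].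
    specialize (Hge (vscal (-1) v)).
    rewrite (@linear_scal X R_ips _ _ (Dphi xs) (-1) v) in Hge by apply Hphi.
    rewrite (linear_scal (DU xs) (-1) v) in Hge by apply HU.
    rewrite ip_scalr in Hge; simpl in Hge; lra.
  - exists (fun i => snd (q (N + s i)%nat)), (fun i => lam (N + s i)%nat).
    repeat split; auto; intro i; [ apply Hq | apply Hcrit ].
Qed.

Lemma second_order_growth {X Z : ipspace} {HX : fd_ips X} {HZ : fd_ips Z}
  (phi : X -> R) (Dphi : X -> X -> R) (D2phi : X -> X -> X -> R)
  (U : X -> Z) (DU : X -> X -> Z) (D2U : X -> X -> X -> Z) (C : Z -> Prop) (xs d v : X) :
  @twice_diff X R_ips phi Dphi D2phi -> twice_diff U DU D2U ->
  local_min phi (feasible U C) xs -> metric_subregular U C xs ->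
  Dphi xs d <= 0 ->
  outer_so_tangent C (U xs) (DU xs d) (vadd (DU xs v) (D2U xs d d)) ->
  0 <= Dphi xs v + D2phi xs d d.
Proof.
  intros Hphi HU [HS (r2 & Hr2 & Hmin)] (kap & r3 & Hkap & Hr3 & Hsub) Hd (t & [Ht Ht0] & Hw).
  destruct (@locally_lipschitz X R_ips _ _ phi Dphi D2phi xs Hphi) as (l & r1 & Hl & Hr1 & Hlip).
  set (d0 := Rmin r1 (Rmin r2 r3)).
  assert (Hd0 : 0 < d0) by (repeat apply Rmin_glb_lt; auto).
  assert (H1 : d0 <= r1) by apply Rmin_l.
  assert (H2 : d0 <= r2) by (eapply Rle_trans; [ apply Rmin_r | apply Rmin_l ]).
  assert (H3 : d0 <= r3) by (eapply Rle_trans; [ apply Rmin_r | apply Rmin_r ]).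
  set (w := vadd (DU xs v) (D2U xs d d)) in *.
  (* In units of [eps s^2]: the Taylor error of [U] and the tangency error give distance [2] to [C],
     the slack in subregularity makes it [3 kap] to the feasible set, the Lipschitz constant
     multiplies by [l], and the Taylor error of [phi] adds [1]. Dividing by [s^2 / 2] doubles the
     total. *)
  apply le_of_le_add_small with (2 * (1 + 3 * l * kap)) 1; [ lra | ].
  intros eps Heps.
  destruct (taylor2_so_path U DU D2U xs d v eps HU) as (e1 & He1 & HT1); [ lra | ].
  fold w in HT1.
  destruct (@taylor2_so_path X R_ips _ _ phi Dphi D2phi xs d v eps Hphi) as (e2 & He2 & HT2); [ lra | ].
  destruct (Hw eps) as [N1 HN1]; [ lra | ].
  destruct (Ht0 (Rmin e1 e2)) as [N2 HN2]; [ apply Rmin_glb_lt; auto | ].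
  destruct (so_path_cv xs d v t Ht0 (d0 / 2)) as [N3 HN3]; [ lra | ].
  destruct (R_cv_scal (3 * kap * eps) _ _ (R_cv_mult _ _ _ _ Ht0 Ht0) (d0 / 2)) as [N4 HN4]; [ lra | ].
  set (k := (N1 + N2 + N3 + N4)%nat).
  specialize (HN1 k ltac:(unfold k; lia)); specialize (HN2 k ltac:(unfold k; lia)).
  specialize (HN3 k ltac:(unfold k; lia)); specialize (HN4 k ltac:(unfold k; lia)).
  cbv beta in HN3, HN4; specialize (Ht k); set (s := t k) in *; clearbody s.
  rewrite Rminus_0_r, Rabs_pos_eq in HN2 by lra.
  pose proof (Rmin_l e1 e2); pose proof (Rmin_r e1 e2).
  specialize (HT1 s ltac:(lra)); specialize (HT2 s ltac:(lra)).
  rewrite norm_R in HT2.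
  pose proof (Rle_abs (3 * kap * eps * (s * s) - 3 * kap * eps * (0 * 0))) as HN4'.
  assert (Hss : 0 < s * s) by nra.
  set (x := so_path xs d v s) in *.
  destruct (Hsub x ltac:(lra) (2 * eps * (s * s))) with (eta := kap * eps * (s * s))
    as (x' & Hx' & Hn).
  { intros eta Heta; destruct (HN1 eta Heta) as (c & Hc & Hcn); exists c; split; auto.
    pose proof (norm_sub_triangle (so_path (U xs) (DU xs d) w s) (U x) c); lra. }
  { apply Rmult_lt_0_compat; [ apply Rmult_lt_0_compat | ]; lra. }
  assert (Hx'd : norm (vsub x' xs) < d0).
  { pose proof (norm_sub_triangle x x' xs); rewrite (norm_sub_sym x' x) in *; lra. }
  specialize (Hmin x' Hx' ltac:(lra)).
  specialize (Hlip x x' ltac:(lra) ltac:(lra)); rewrite norm_R in Hlip; simpl in Hlip.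
  rewrite (norm_sub_sym x' x) in Hlip.
  pose proof (Rle_abs (phi x' + - phi x)).
  pose proof (Rle_trans _ _ _ (Rle_abs _) HT2) as Habs.
  unfold so_path, vsub in Habs; simpl in Habs.
  assert (l * norm (vsub x x') <= l * (3 * kap * eps * (s * s))) by (apply Rmult_le_compat_l; lra).
  assert (s * Dphi xs d <= 0) by nra.
  apply Rmult_le_reg_r with (/ 2 * (s * s)); lra.
Qed.

(** * Convex duality *)

Lemma expand_perp {E : ipspace} {HE : fd_ips E} (l : list E) (x : E) :
  (forall f, In f l -> ip x f = 0) -> expand l x = vzero.
Proof.
  induction l as [ | e l IH]; simpl; intro H; auto.
  rewrite IH, H by auto; veq.
Qed.

(** Points with [t > 0] demand [alpha >= - s / t], points with [t < 0] demand [alpha <= s / (- t)].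
    A convex combination of one of each kind lies over the origin, so every lower demand is below
    every upper one; [alpha] is the supremum of the former, finite because absorption supplies a
    point on the other side. *)
Lemma one_step_slope {Z : ipspace} {HZ : fd_ips Z} (S : Z -> R -> Prop) (e : Z) :
  (forall z s z' s' a, 0 <= a <= 1 -> S z s -> S z' s' ->
     S (vadd (vscal a z) (vscal (1 - a) z')) (a * s + (1 - a) * s')) ->
  (forall s, S vzero s -> 0 <= s) ->
  (forall z s, S z s -> exists tau s', 0 < tau /\ S (vscal (- tau) z) s') ->
  exists alpha, forall t s, S (vscal t e) s -> 0 <= s + alpha * t.
Proof.
  intros Hconv H0 Habs.
  assert (Hcomp : forall t s t' s', 0 < t -> 0 < t' -> S (vscal t e) s -> S (vscal (- t') e) s' ->
     0 <= t' * s + t * s').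
  { intros t s t' s' Ht Ht' Hs Hs'.
    assert (Ha : 0 <= t' / (t + t') <= 1).
    { split; [ apply Rlt_le, Rdiv_lt_0_compat; lra | ].
      apply Rmult_le_reg_r with (t + t'); [ lra | ].
      replace (t' / (t + t') * (t + t')) with t' by (field; lra); lra. }
    pose proof (Hconv _ _ _ _ _ Ha Hs Hs') as H.
    replace (vadd _ _) with (@vzero Z) in H by (apply ip_ext; intro x; ipl; field; lra).
    apply H0 in H; apply (Rmult_le_compat_l (t + t')) in H; [ | lra ].
    rewrite Rmult_0_r in H.
    replace ((t + t') * (t' / (t + t') * s + (1 - t' / (t + t')) * s'))
      with (t' * s + t * s') in H by (field; lra); auto. }
  destruct (classic (exists t s, 0 < t /\ S (vscal t e) s)) as [(t1 & s1 & Ht1 & Hs1) | Hno].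
  - destruct (Habs _ _ Hs1) as (tau & s2 & Htau & Hs2).
    rewrite vscal_vscal in Hs2; replace (- tau * t1) with (- (tau * t1)) in Hs2 by ring.
    assert (Ht2 : 0 < tau * t1) by (apply Rmult_lt_0_compat; auto).
    assert (Hub : forall t' s', 0 < t' -> S (vscal (- t') e) s' ->
      is_upper_bound (fun r => exists t s, 0 < t /\ S (vscal t e) s /\ r = - s / t) (s' / t')).
    { intros t' s' Ht' Hs' r (t & s & Ht & Hs & ->).
      specialize (Hcomp t s t' s' Ht Ht' Hs Hs').
      apply Rmult_le_reg_r with (t * t'); [ nra | ].
      replace (- s / t * (t * t')) with (- (t' * s)) by (field; lra).
      replace (s' / t' * (t * t')) with (t * s') by (field; lra); lra. }
    destruct (completeness (fun r => exists t s, 0 < t /\ S (vscal t e) s /\ r = - s / t))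
      as [alpha [Hal1 Hal2]].
    { exists (s2 / (tau * t1)); apply Hub; auto. }
    { exists (- s1 / t1), t1, s1; auto. }
    exists alpha; intros t s Hs.
    destruct (Rtotal_order t 0) as [Ht | [-> | Ht]].
    + assert (H : alpha <= s / - t).
      { apply Hal2, Hub; [ lra | rewrite Ropp_involutive; auto ]. }
      apply (Rmult_le_compat_r (- t)) in H; [ | lra ].
      replace (s / - t * - t) with s in H by (field; lra); lra.
    + rewrite vscal0 in Hs; apply H0 in Hs; lra.
    + assert (H : - s / t <= alpha) by (apply Hal1; exists t, s; auto).
      apply (Rmult_le_compat_r t) in H; [ | lra ].
      replace (- s / t * t) with (- s) in H by (field; lra); lra.
  (* With no point at [t > 0], absorption excludes [t < 0] too, and any slope would do. *)
  - exists 0; intros t s Hs.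
    destruct (Rtotal_order t 0) as [Ht | [-> | Ht]].
    + exfalso; destruct (Habs _ _ Hs) as (tau & s' & Htau & Hs').
      apply Hno; exists (- tau * t), s'; split; [ nra | rewrite <- vscal_vscal; auto ].
    + rewrite vscal0 in Hs; apply H0 in Hs; lra.
    + exfalso; apply Hno; exists t, s; auto.
Qed.

(* Hahn-Banach, one orthonormal direction at a time.  The last hypothesis says that the
   origin is in the relative interior of the projection of [S]; it is inherited by the
   projection of [S] along [(e, - alpha)]. *)
Lemma convex_set_linear_minorant {Z : ipspace} {HZ : fd_ips Z} (l : list Z) :
  forall S : Z -> R -> Prop,
  ortho l -> (forall z s, S z s -> expanded_by l z) ->
  (forall z s z' s' a, 0 <= a <= 1 -> S z s -> S z' s' ->
     S (vadd (vscal a z) (vscal (1 - a) z')) (a * s + (1 - a) * s')) ->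
  (forall s, S vzero s -> 0 <= s) ->
  (forall z s, S z s -> exists tau s', 0 < tau /\ S (vscal (- tau) z) s') ->
  exists m, forall z s, S z s -> 0 <= ip m z + s.
Proof.
  induction l as [ | e l IH]; intros S Ho Hexp Hconv H0 Habs.
  - exists vzero; intros z s Hs; rewrite ip_zerol.
    pose proof (Hexp z s Hs) as Hz; unfold expanded_by in Hz; simpl in Hz; subst z.
    apply H0 in Hs; lra.
  - destruct Ho as (He1 & Hel & Ho).
    destruct (one_step_slope S e Hconv H0 Habs) as (alpha & Hal).
    set (pr := fun z => vsub z (vscal (ip z e) e)).
    assert (Hpr : forall z s, S z s -> pr z = expand l z).
    { intros z s Hs; pose proof (Hexp z s Hs) as Hz; unfold expanded_by in Hz; simpl in Hz.
      unfold pr; rewrite Hz at 1; veq. }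
    destruct (IH (fun z' s' => exists z s, S z s /\ z' = pr z /\ s' = s + alpha * ip z e))
      as (m & Hm); auto.
    + intros z' s' (z & s & Hs & -> & ->); unfold expanded_by.
      rewrite (Hpr z s Hs) at 1; unfold pr.
      replace (vsub z (vscal (ip z e) e)) with (vadd (vscal 1 z) (vscal (- ip z e) e)) by veq.
      rewrite expand_lin, (expand_perp l e) by auto; veq.
    + intros z1 s1 z2 s2 a Ha (u1 & r1 & H1 & -> & ->) (u2 & r2 & H2 & -> & ->).
      exists (vadd (vscal a u1) (vscal (1 - a) u2)), (a * r1 + (1 - a) * r2); repeat split; auto.
      * unfold pr; ipl; veq.
      * ipl; ring.
    (* The fibre of the projection over the origin comes from the line spanned by [e], where [alpha]
       was chosen. *)
    + intros s' (z & s & Hs & Hz & ->).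
      apply Hal; replace (vscal (ip z e) e) with z; auto.
      symmetry in Hz; apply vsub0_eq in Hz; exact Hz.
    + intros z' s' (z & s & Hs & -> & ->).
      destruct (Habs z s Hs) as (tau & s' & Htau & Hs').
      exists tau, (s' + alpha * ip (vscal (- tau) z) e); split; auto.
      exists (vscal (- tau) z), s'; repeat split; auto.
      unfold pr; ipl; veq.
    (* This vector acts like [m] orthogonally to [e] and takes the value [alpha] on [e]. *)
    + exists (vadd m (vscal (alpha - ip m e) e)); intros z s Hs.
      specialize (Hm (pr z) (s + alpha * ip z e)).
      assert (H : 0 <= ip m (pr z) + (s + alpha * ip z e)) by (apply Hm; exists z, s; auto).
      unfold pr, vsub in H; rewrite ip_addr, ip_oppr, ip_scalr in H.
      rewrite ip_addl, ip_scall, (ip_sym e z); lra.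
Qed.

(** Separation for the perturbation set of pairs [(L v + b - w, s)] with [w] in [D] and
    [s >= c v + g]. Over the origin [w = L v + b] lies in [D], which is where [Hpos] applies. *)
Lemma convex_linear_duality {X Z : ipspace} {HX : fd_ips X} {HZ : fd_ips Z}
  (L : X -> Z) (c : X -> R) (b z0 : Z) (v0 : X) (g : R) (D : Z -> Prop) :
  is_linear L -> @is_linear X R_ips c -> convex D -> rel_int D z0 -> z0 = vadd (L v0) b ->
  (forall v, D (vadd (L v) b) -> 0 <= c v + g) ->
  exists m, forall v w, D w -> 0 <= ip m (vsub (vadd (L v) b) w) + (c v + g).
Proof.
  intros HL Hc HD [Hz0 (eps & Heps & Hri)] Ez0 Hpos.
  destruct (@orthonormal_basis Z HZ) as (l & Ho & Hl).
  destruct (convex_set_linear_minorant l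
    (fun z s => exists v w, D w /\ z = vsub (vadd (L v) b) w /\ c v + g <= s)) as (m & Hm).
  - exact Ho.
  - intros z s _; apply Hl.
  - intros z1 s1 z2 s2 a Ha (v1 & w1 & Hw1 & -> & H1) (v2 & w2 & Hw2 & -> & H2).
    exists (vadd (vscal a v1) (vscal (1 - a) v2)), (vadd (vscal a w1) (vscal (1 - a) w2)).
    repeat split; auto.
    + rewrite (HL a); veq.
    + pose proof (Hc a (1 - a) v1 v2) as Hcv; simpl in Hcv; rewrite Hcv; nra.
  - intros s (v & w & Hw & Hz & Hs).
    symmetry in Hz; apply vsub0_eq in Hz; rewrite <- Hz in Hw.
    specialize (Hpos v Hw); lra.
  - intros z s (v & w & Hw & -> & Hs).
    pose proof (norm_pos (vsub z0 w)) as Hn.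
    (* Reflecting [w] slightly through the relative interior point [z0] gives
       [(1 + tau) z0 - tau w], an affine combination within [eps] of [z0] and hence in [D]. The same
       reflection of [v] through [v0] gives [v']. *)
    set (tau := eps / (norm (vsub z0 w) + 1)).
    assert (Htau : 0 < tau) by (apply Rdiv_lt_0_compat; lra).
    assert (Htau' : tau * (norm (vsub z0 w) + 1) = eps) by (unfold tau; field; lra).
    set (v' := vadd (vscal (1 + tau) v0) (vscal (- tau) v)).
    exists tau, (c v' + g); split; auto.
    exists v', (vadd (vscal (1 + tau) z0) (vscal (- tau) w)); repeat split; [ | | lra ].
    + apply Hri.
      * exists [(1 + tau, z0); (- tau, w)]; repeat split.
        -- repeat constructor; auto.
        -- simpl; ring.
        -- simpl; veq.
      * replace (vsub _ z0) with (vscal tau (vsub z0 w)) by veq.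
        rewrite norm_scal_pos by lra; lra.
    + unfold v'; rewrite HL, Ez0; veq.
  - exists m; intros v w Hw; apply Hm; exists v, w; repeat split; auto; lra.
Qed.

(** One dual inequality in [v], [w], [u] yields everything: scaling [v] forces the gradient to
    vanish, scaling [u] in the Clarke tangent cone forces [<m, u> <= 0], and [u = 0] leaves the
    support bound. *)
Lemma second_order_dual_condition {X Z : ipspace} {HX : fd_ips X} {HZ : fd_ips Z}
  (phi : X -> R) (Dphi : X -> X -> R) (D2phi : X -> X -> X -> R)
  (U : X -> Z) (DU : X -> X -> Z) (D2U : X -> X -> X -> Z) (C : Z -> Prop) (xs d : X)
  (T : Z -> Prop) :
  @twice_diff X R_ips phi Dphi D2phi -> twice_diff U DU D2U -> closed C ->
  local_min phi (feasible U C) xs -> metric_subregular U C xs ->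
  critical_cone Dphi U DU C xs d ->
  (exists w, T w) -> convex T ->
  (forall w, T w -> outer_so_tangent C (U xs) (DU xs d) w) ->
  (exists z, rel_int (set_sum T (clarke_tangent C (U xs))) z /\
             exists v, z = vadd (DU xs v) (D2U xs d d)) ->
  exists m, mult_set clarke_normal Dphi U DU C xs m /\
    support_le T m (hess_Lagr D2phi D2U xs m d).
Proof.
  intros Hphi HU HC Hmin Hsub [Hd _] [w0 Hw0] HTc HT (z0 & Hri & v0 & Ez0).
  assert (HD : convex (set_sum T (clarke_tangent C (U xs)))).
  { intros z z' (a & u & Ha & Hu & ->) (a' & u' & Ha' & Hu' & ->) r Hr.
    exists (vadd (vscal r a) (vscal (1 - r) a')), (vadd (vscal r u) (vscal (1 - r) u')).
    repeat split; [ apply HTc; auto | | veq ].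
    apply clarke_tangent_add; apply clarke_tangent_scal; auto; lra. }
  destruct (Hphi xs) as ((HLphi & _) & _); destruct (HU xs) as ((HLU & _) & _).
  destruct (convex_linear_duality (DU xs) (Dphi xs) (D2U xs d d) z0 v0 (D2phi xs d d)
    (set_sum T (clarke_tangent C (U xs)))) as (m & Hm); auto.
  { intros v (w & u & Hw & Hu & Hwu).
    apply (second_order_growth phi Dphi D2phi U DU D2U C xs d v); auto.
    rewrite Hwu; apply outer_so_tangent_add_clarke; auto; apply Hmin. }
  assert (Hm' : forall v w u, T w -> clarke_tangent C (U xs) u ->
    0 <= ip m (DU xs v) + ip m (D2U xs d d) - ip m w - ip m u + (Dphi xs v + D2phi xs d d)).
  { intros v w u Hw Hu.
    assert (H : set_sum T (clarke_tangent C (U xs)) (vadd w u)) by (exists w, u; auto).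
    specialize (Hm v (vadd w u) H); unfold vsub in Hm; rewrite !ip_addr, ip_oppr, ip_addr in Hm.
    lra. }
  assert (Hgrad : forall v, Dphi xs v + ip m (DU xs v) >= 0).
  { intro v; apply Rnot_lt_ge; intro Hlt.
    pose proof (Hm' vzero w0 vzero Hw0 (clarke_tangent_zero C (U xs))) as H1.
    set (K := ip m (D2U xs d d) - ip m w0 - ip m vzero + D2phi xs d d) in *.
    (* Scaled so that the right side of the dual inequality becomes [K - |K| - 1 < 0]. *)
    set (s := (Rabs K + 1) / - (Dphi xs v + ip m (DU xs v))).
    pose proof (Hm' (vscal s v) w0 vzero Hw0 (clarke_tangent_zero C (U xs))) as H2.
    rewrite (linear_scal (DU xs)) in H2 by auto.
    rewrite (@linear_scal X R_ips _ _ (Dphi xs)) in H2 by auto.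
    rewrite ip_scalr in H2; simpl in H2.
    assert (Hs : s * (Dphi xs v + ip m (DU xs v)) = - (Rabs K + 1)) by (unfold s; field; lra).
    pose proof (Rle_abs K); unfold K in *; lra. }
  assert (Hgrad0 : grad_Lagr_zero Dphi DU xs m).
  { intro v; pose proof (Hgrad v) as H1; pose proof (Hgrad (vscal (-1) v)) as H2.
    rewrite (linear_scal (DU xs)) in H2 by auto.
    rewrite (@linear_scal X R_ips _ _ (Dphi xs)) in H2 by auto.
    rewrite ip_scalr in H2; simpl in H2; lra. }
  assert (Hm0 : forall w u, T w -> clarke_tangent C (U xs) u ->
    ip m w + ip m u <= hess_Lagr D2phi D2U xs m d).
  { intros w u Hw Hu; pose proof (Hm' v0 w u Hw Hu) as H; specialize (Hgrad0 v0).
    unfold hess_Lagr; lra. }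
  exists m; split; [ split; auto | ].
  - apply polar_clarke_tangent_normal; auto; [ apply Hmin | ].
    intros u Hu; apply Rnot_lt_le; intro Hlt.
    set (K := hess_Lagr D2phi D2U xs m d - ip m w0).
    assert (Hs0 : 0 <= (Rabs K + 1) / ip m u).
    { pose proof (Rabs_pos K); apply Rlt_le, Rdiv_lt_0_compat; lra. }
    pose proof (Hm0 w0 _ Hw0 (clarke_tangent_scal C (U xs) u _ Hs0 Hu)) as H.
    rewrite ip_scalr in H.
    replace ((Rabs K + 1) / ip m u * ip m u) with (Rabs K + 1) in H by (field; lra).
    pose proof (Rle_abs K); unfold K in *; lra.
  - intros w Hw; pose proof (Hm0 w vzero Hw (clarke_tangent_zero C (U xs))) as H.
    rewrite ip_zeror in H; lra.
Qed.

(** * The cone [Omega] and product maps *)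

Lemma sumR_ext (n : nat) (f g : nat -> R) :
  (forall i, (i < n)%nat -> f i = g i) -> sumR n f = sumR n g.
Proof.
  induction n as [ | n IH]; simpl; intro H; auto.
  rewrite IH, H by (intros; auto with arith); reflexivity.
Qed.

Lemma sumR_lin (n : nat) (a b : R) (f g : nat -> R) :
  sumR n (fun i => a * f i + b * g i) = a * sumR n f + b * sumR n g.
Proof. induction n as [ | n IH]; simpl; [ ring | rewrite IH; ring ]. Qed.

Lemma sumR_nonneg (n : nat) (f : nat -> R) : (forall i, 0 <= f i) -> 0 <= sumR n f.
Proof. intro H; induction n as [ | n IH]; simpl; [ lra | specialize (H n); lra ]. Qed.

Lemma sumR_nonneg_eq0 (n : nat) (f : nat -> R) :
  (forall i, 0 <= f i) -> sumR n f = 0 -> forall i, (i < n)%nat -> f i = 0.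
Proof.
  intro H; induction n as [ | n IH]; simpl; intros H0 i Hi; [ lia | ].
  pose proof (sumR_nonneg n f H); pose proof (H n).
  destruct (Nat.eq_dec i n) as [-> | Hne]; [ lra | apply IH; [ lra | lia ] ].
Qed.

(* Also [0] for [a >= n], so that matrices built from it satisfy the support condition of [is_symn]. *)
Definition kron (n a i : nat) : R := if ((a =? i)%nat && (a <? n)%nat)%bool then 1 else 0.

Lemma kron_sum (n b : nat) (f : nat -> R) (m : nat) :
  sumR m (fun j => kron n b j * f j) = if ((b <? m)%nat && (b <? n)%nat)%bool then f b else 0.
Proof.
  induction m as [ | m IH]; simpl.
  - destruct (Nat.ltb_spec b 0); [ lia | reflexivity ].
  - rewrite IH; unfold kron.
    destruct (Nat.eqb_spec b m), (Nat.ltb_spec b m), (Nat.ltb_spec b n), (Nat.ltb_spec b (S m));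
      simpl; subst; try lia; ring.
Qed.

(** The matrix [E_ij + E_ji], equal to [2 E_ii] on the diagonal; summing over all [i, j < n] with
    coefficients [A i j / 2] therefore returns [A]. *)
Lemma symn_unit (n i j : nat) :
  is_symn n (fun a b => kron n a i * kron n b j + kron n a j * kron n b i).
Proof.
  split; intros a b; [ ring | ].
  unfold kron; intros [H | H].
  - destruct (Nat.ltb_spec a n); [ lia | rewrite !Bool.andb_false_r; ring ].
  - destruct (Nat.ltb_spec b n); [ lia | rewrite !Bool.andb_false_r; ring ].
Qed.

(** [fd_ips] is stated with Leibniz equality, and an element of [Symn n] is a function packed with a
    proof; hence functional extensionality and proof irrelevance. *)
Lemma Symn_ext (n : nat) (A B : Symn n) :
  (forall i j, proj1_sig A i j = proj1_sig B i j) -> A = B.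
Proof.
  intro H; apply eq_sig_hprop; [ intros; apply proof_irrelevance | ].
  apply functional_extensionality; intro i; apply functional_extensionality; intro j; auto.
Qed.

Lemma lincomb_seq_entry (n : nat) (c : nat -> R) (B : nat -> Symn n) (m a b : nat) :
  proj1_sig (@lincomb (Sym_ips n) (map (fun j => (c j, B j)) (seq 0 m))) a b
  = sumR m (fun j => c j * proj1_sig (B j) a b).
Proof.
  assert (Happ : forall l l', proj1_sig (@lincomb (Sym_ips n) (l ++ l')) a b
     = proj1_sig (@lincomb (Sym_ips n) l) a b + proj1_sig (@lincomb (Sym_ips n) l') a b).
  { induction l as [ | [x u] l IH]; intro l'; simpl; [ ring | rewrite IH; ring ]. }
  induction m as [ | m IH]; auto.
  rewrite seq_S, map_app, Happ, IH; simpl; ring.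
Qed.

Lemma lincomb_flat_map_entry (n : nat) (F : nat -> list (R * Sym_ips n)) (m a b : nat) :
  proj1_sig (@lincomb (Sym_ips n) (flat_map F (seq 0 m))) a b
  = sumR m (fun i => proj1_sig (@lincomb (Sym_ips n) (F i)) a b).
Proof.
  assert (Happ : forall l l', proj1_sig (@lincomb (Sym_ips n) (l ++ l')) a b
     = proj1_sig (@lincomb (Sym_ips n) l) a b + proj1_sig (@lincomb (Sym_ips n) l') a b).
  { induction l as [ | [x u] l IH]; intro l'; simpl; [ ring | rewrite IH; ring ]. }
  induction m as [ | m IH]; auto.
  rewrite seq_S, flat_map_app, Happ, IH; simpl; rewrite app_nil_r; reflexivity.
Qed.

#[export] Instance fd_ips_Sym (n : nat) : fd_ips (Sym_ips n).
Proof.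
  assert (Hsq : forall A : Symn n, forall i j : nat, 0 <= proj1_sig A i j * proj1_sig A j i).
  { intros A i j; rewrite (proj1 (proj2_sig A) j i); apply Rle_0_sqr. }
  repeat split; try (intros; apply Symn_ext; intros; simpl; ring).
  - intros A B; simpl; unfold trace_ip.
    apply sumR_ext; intros i _; apply sumR_ext; intros j _.
    rewrite (proj1 (proj2_sig A) i j), (proj1 (proj2_sig B) j i); ring.
  - intros a b A B D; simpl; unfold trace_ip; rewrite <- sumR_lin.
    apply sumR_ext; intros i _; rewrite <- sumR_lin; apply sumR_ext; intros j _; ring.
  - intros A; simpl; unfold trace_ip; apply sumR_nonneg; intro; apply sumR_nonneg; auto.
  - intros A H; simpl in H; unfold trace_ip in H; apply Symn_ext; intros i j; simpl.
    destruct (Nat.le_gt_cases n i) as [Hi | Hi]; [ apply (proj2_sig A); auto | ].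
    destruct (Nat.le_gt_cases n j) as [Hj | Hj]; [ apply (proj2_sig A); auto | ].
    apply (sumR_nonneg_eq0 n) with (i := i) in H; auto.
    + apply (sumR_nonneg_eq0 n) with (i := j) in H; auto.
      rewrite (proj1 (proj2_sig A) j i) in H; apply Rsqr_0_uniq; exact H.
    + intro; apply sumR_nonneg; auto.
  - exists (flat_map (fun i => map (fun j => exist _ _ (symn_unit n i j)) (seq 0 n)) (seq 0 n)).
    intro A.
    exists (flat_map (fun i => map (fun j => (proj1_sig A i j / 2,
      exist (is_symn n) _ (symn_unit n i j) : Sym_ips n)) (seq 0 n)) (seq 0 n)); split.
    + apply Forall_forall; intros [c B] H; simpl.
      apply in_flat_map in H; destruct H as (i & Hi & H).
      apply in_map_iff in H; destruct H as (j & [= <- <-] & Hj).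
      apply in_flat_map; exists i; split; auto.
      apply in_map_iff; exists j; auto.
    + apply Symn_ext; intros a b; rewrite lincomb_flat_map_entry.
      rewrite (sumR_ext n _ (fun i =>
        kron n a i * (sumR n (fun j => kron n b j * (proj1_sig A i j / 2)))
        + kron n b i * (sumR n (fun j => kron n a j * (proj1_sig A i j / 2))))).
      2:{ intros i _; rewrite lincomb_seq_entry, <- sumR_lin.
          apply sumR_ext; intros j _; simpl; ring. }
      (* The factors [1] give the summand the shape expected by [sumR_lin]. *)
      rewrite (sumR_ext n _ (fun i =>
        1 * (kron n a i * (sumR n (fun j => kron n b j * (proj1_sig A i j / 2))))
        + 1 * (kron n b i * (sumR n (fun j => kron n a j * (proj1_sig A i j / 2))))))
        by (intros; ring).
      rewrite sumR_lin, !kron_sum.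
      destruct (Nat.ltb_spec a n) as [Ha | Ha], (Nat.ltb_spec b n) as [Hb | Hb]; simpl;
        [ rewrite (proj1 (proj2_sig A) b a); field | | | ];
        rewrite (proj2 (proj2_sig A) a b) by auto; ring.
Qed.

(** The matrix [v v^T], cut off outside the [n] by [n] block. Pairing with it makes the quadratic
    form a continuous linear function of the matrix, so semidefiniteness passes to limits. *)
Lemma symn_outer (n : nat) (v : nat -> R) :
  is_symn n (fun i j => if ((i <? n)%nat && (j <? n)%nat)%bool then v i * v j else 0).
Proof.
  split; intros i j.
  - rewrite Bool.andb_comm; destruct (_ && _)%bool; ring.
  - intros [H | H]; [ destruct (Nat.ltb_spec i n) | destruct (Nat.ltb_spec j n) ];
      try lia; rewrite ?Bool.andb_false_r; reflexivity.
Qed.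

Lemma quadform_ip (n : nat) (A : Symn n) (v : nat -> R) :
  quadform n (proj1_sig A) v = @ip (Sym_ips n) A (exist _ _ (symn_outer n v)).
Proof.
  simpl; unfold quadform, trace_ip; apply sumR_ext; intros i Hi; apply sumR_ext; intros j Hj; simpl.
  destruct (Nat.ltb_spec i n), (Nat.ltb_spec j n); try lia; simpl; ring.
Qed.

Lemma closed_Omega (n : nat) : closed (Omega n).
Proof.
  intros u a Hu Ha.
  pose proof (seq_cv_fst _ _ Ha) as H1; pose proof (seq_cv_snd _ _ Ha) as H2.
  repeat split.
  - intro v; rewrite quadform_ip.
    apply R_cv_le with (fun _ => 0)
      (fun k => @ip (Sym_ips n) (fst (u k)) (exist _ _ (symn_outer n v))).
    + intro k; rewrite <- quadform_ip; apply (Hu k).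
    + apply R_cv_const.
    + apply R_cv_ip; [ exact H1 | apply seq_cv_const ].
  - intro v; rewrite quadform_ip.
    apply R_cv_le with
      (fun k => @ip (Sym_ips n) (snd (u k)) (exist _ _ (symn_outer n v))) (fun _ => 0).
    + intro k; rewrite <- quadform_ip; apply (Hu k).
    + apply R_cv_ip; [ exact H2 | apply seq_cv_const ].
    + apply R_cv_const.
  - apply R_cv_unique with (fun k => @ip (Sym_ips n) (fst (u k)) (snd (u k))).
    + apply R_cv_ip; [ exact H1 | exact H2 ].
    + intros eps Heps; exists 0%nat; intros k _.
      destruct (Hu k) as (_ & _ & ->); rewrite Rminus_0_r, Rabs_R0; auto.
Qed.

Lemma closed_prod_set {E F : ipspace} {HE : fd_ips E} {HF : fd_ips F} (A : E -> Prop) (B : F -> Prop) :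
  closed A -> closed B -> closed (prod_set A B).
Proof.
  intros HA HB u a Hu Ha; split.
  - apply HA with (fun k => fst (u k)); [ intro; apply Hu | apply seq_cv_fst; auto ].
  - apply HB with (fun k => snd (u k)); [ intro; apply Hu | apply seq_cv_snd; auto ].
Qed.

Lemma linear_pair {X E F : ipspace} (L : X -> E) (M : X -> F) :
  is_linear L -> is_linear M -> @is_linear X (prod_ips E F) (fun x => (L x, M x)).
Proof. intros HL HM a b x y; simpl; rewrite HL, HM; reflexivity. Qed.

Lemma twice_diff_pair {X E F : ipspace} {HE : fd_ips E} {HF : fd_ips F}
  (f : X -> E) Df D2f (g : X -> F) Dg D2g :
  twice_diff f Df D2f -> twice_diff g Dg D2g ->
  @twice_diff X (prod_ips E F) (fun x => (f x, g x)) (fun x u => (Df x u, Dg x u))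
    (fun x u v => (D2f x u v, D2g x u v)).
Proof.
  intros Hf Hg x.
  destruct (Hf x) as ([Lf Tf] & Bf1 & Bf2 & Sf); destruct (Hg x) as ([Lg Tg] & Bg1 & Bg2 & Sg).
  split; [ split | split; [ | split ] ].
  - apply linear_pair; auto.
  - intros eps Heps.
    destruct (Tf (eps / 2)) as (d1 & Hd1 & H1); [ lra | ].
    destruct (Tg (eps / 2)) as (d2 & Hd2 & H2); [ lra | ].
    exists (Rmin d1 d2); split; [ apply Rmin_glb_lt; auto | ]; intros h Hh.
    pose proof (Rmin_l d1 d2); pose proof (Rmin_r d1 d2).
    specialize (H1 h ltac:(lra)); specialize (H2 h ltac:(lra)).
    eapply Rle_trans; [ apply norm_pair_le | ].
    eapply Rle_trans; [ apply Rplus_le_compat; [ exact H1 | exact H2 ] | lra ].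
  - intro h; apply linear_pair; auto.
  - intro u; apply (linear_pair (fun h => D2f x h u) (fun h => D2g x h u)); auto.
  - intros eps Heps.
    destruct (Sf (eps / 2)) as (d1 & Hd1 & H1); [ lra | ].
    destruct (Sg (eps / 2)) as (d2 & Hd2 & H2); [ lra | ].
    exists (Rmin d1 d2); split; [ apply Rmin_glb_lt; auto | ]; intros h Hh u.
    pose proof (Rmin_l d1 d2); pose proof (Rmin_r d1 d2).
    specialize (H1 h ltac:(lra) u); specialize (H2 h ltac:(lra) u).
    eapply Rle_trans; [ apply norm_pair_le | ].
    eapply Rle_trans; [ apply Rplus_le_compat; [ exact H1 | exact H2 ] | lra ].
Qed.

Theorem theorem5p1
  (X Y : ipspace) (n : nat) (HX : fd_ips X) (HY : fd_ips Y)
  (phi : X -> R) (Dphi : X -> X -> R) (D2phi : X -> X -> X -> R)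
  (h : X -> Y) (Dh : X -> X -> Y) (D2h : X -> X -> X -> Y)
  (theta zeta : X -> Sym_ips n) (Dtheta Dzeta : X -> X -> Sym_ips n)
  (D2theta D2zeta : X -> X -> X -> Sym_ips n)
  (K : Y -> Prop)
  (Hphi : @twice_diff X R_ips phi Dphi D2phi)
  (Hh : twice_diff h Dh D2h)
  (Htheta : twice_diff theta Dtheta D2theta)
  (Hzeta : twice_diff zeta Dzeta D2zeta)
  (HK : closed_convex_cone K)
  (HKreg : second_order_regular K)
  (xs : X)
  (Hopt : local_min phi (feasible (Ups h theta zeta) (KOmega n K)) xs)
  (Hsub : metric_subregular (Ups h theta zeta) (KOmega n K) xs) :
  (exists m, mult_set limiting_normal Dphi (Ups h theta zeta)
               (DUps Dh Dtheta Dzeta) (KOmega n K) xs m) /\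
  forall d : X,
    critical_cone Dphi (Ups h theta zeta) (DUps Dh Dtheta Dzeta) (KOmega n K) xs d ->
    forall T : Zsp Y n -> Prop,
      (exists w, T w) -> convex T ->
      (forall w, T w -> outer_so_tangent (KOmega n K) (Ups h theta zeta xs)
                          (DUps Dh Dtheta Dzeta xs d) w) ->
      (exists z, rel_int (set_sum T (clarke_tangent (KOmega n K) (Ups h theta zeta xs))) z /\
                 exists v : X, z = vadd (DUps Dh Dtheta Dzeta xs v)
                                        (D2Ups D2h D2theta D2zeta xs d d)) ->
      sup_q_minus_support_ge0
        (mult_set clarke_normal Dphi (Ups h theta zeta) (DUps Dh Dtheta Dzeta) (KOmega n K) xs)
        (fun m => hess_Lagr D2phi (D2Ups D2h D2theta D2zeta) xs m d)
        T.
Proof.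
  assert (HZ : fd_ips (Zsp Y n)) by (unfold Zsp; exact _).
  assert (HU : twice_diff (Ups h theta zeta) (DUps Dh Dtheta Dzeta) (D2Ups D2h D2theta D2zeta)).
  (* [Ups] and its derivatives unfold to nested pairs matching [Zsp]. *)
  { exact (twice_diff_pair h Dh D2h _ _ _ Hh
      (twice_diff_pair theta Dtheta D2theta zeta Dzeta D2zeta Htheta Hzeta)). }
  assert (HC : closed (KOmega n K)) by (apply closed_prod_set; [ apply HK | apply closed_Omega ]).
  split.
  - apply (limiting_multiplier_exists phi Dphi D2phi _ _ (D2Ups D2h D2theta D2zeta)); auto.
  - intros d Hd T HT HTc HT2 Hri eps Heps.
    (* The multiplier found here satisfies the support bound without the slack [eps]. *)
    destruct (second_order_dual_condition phi Dphi D2phi (Ups h theta zeta)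
      (DUps Dh Dtheta Dzeta) (D2Ups D2h D2theta D2zeta) (KOmega n K) xs d T)
      as (m & Hm & Hs); auto.
    exists m; split; auto; intros w Hw; specialize (Hs w Hw); lra.
Qed.
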